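(* Let $X$ be a nonsingular real algebraic surface and let $f_1,\ldots,f_r$ be continuous rational functions on $X$. For a continuous rational function $\varphi$ on $X$, the following conditions are equivalent: (a) The function $\varphi$ can be written in the form $\varphi=\varphi_1f_1+\cdots+\varphi_rf_r$, where the $\varphi_i$ are continuous rational functions on $X$. (b) The function $\varphi$ can be written in the form $\varphi=\psi_1f_1+\cdots+\psi_rf_r$, where the $\psi_i$ are continuous functions on $X$.
   Context: All functions are real-valued. A real algebraic variety is a locally ringed space isomorphic to an algebraic subset of $\mathbb{R}^n$, for some $n$, endowed with the Zariski topology and the sheaf of regular functions (what is often called an affine real algebraic variety). A real algebraic surface is a real algebraic variety of dimension $2$; it is not assumed irreducible. Each real algebraic variety also carries the Euclidean topology, and all topological notions (in particular continuity) refer to the Euclidean topology unless ''Zariski'' is explicitly mentioned. A function $f$ on a real algebraic variety $X$ is continuous rational if it is continuous on $X$ and regular on some Zariski open dense subset of $X$. *)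

(* Defs.v *)
From mathcomp Require Import all_boot all_order all_algebra.
From mathcomp Require Import all_classical all_reals all_analysis.
(* Not imported: the notations of mpoly clash with those of analysis. *)
From mathcomp Require mpoly.

Set Implicit Arguments.
Unset Strict Implicit.
Unset Printing Implicit Defensive.

Import Order.TTheory GRing.Theory Num.Theory.
Import numFieldNormedType.Exports.

Local Open Scope classical_set_scope.
Local Open Scope ring_scope.

(* Real algebraic varieties (affine, in the sense of the sheaf of regular
   functions) are represented by algebraic subsets X of R^n = 'rV[R]_n, and
   functions on X by total functions 'rV[R]_n -> R of which only the values
   on X matter.  Names starting with z refer to the Zariski topology; the
   library topology of 'rV[R]_n is the Euclidean one. *)

Definition rpoly (R : realType) (n : nat) := mpoly.mpoly n R.

Definition peval (R : realType) (n : nat) (p : rpoly R n) (x : 'rV[R]_n) : R :=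
  mpoly.meval (fun i => x ord0 i) p.

Definition zeros (R : realType) (n : nat) (S : set (rpoly R n)) :
    set 'rV[R]_n :=
  [set x | forall p, S p -> peval p x = 0].

Definition vanishing_ideal (R : realType) (n : nat) (A : set 'rV[R]_n) :
    set (rpoly R n) :=
  [set p | forall x, A x -> peval p x = 0].

Definition algebraic (R : realType) (n : nat) (A : set 'rV[R]_n) : Prop :=
  exists S : set (rpoly R n), A = zeros S.

Definition zopen (R : realType) (n : nat) (U : set 'rV[R]_n) : Prop :=
  algebraic (~` U).

Definition zopen_in (R : realType) (n : nat) (X U : set 'rV[R]_n) : Prop :=
  exists2 V, zopen V & U = X `&` V.

Definition zclosed_in (R : realType) (n : nat) (X Z : set 'rV[R]_n) : Prop :=
  exists2 F, algebraic F & Z = X `&` F.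

Definition zdense_in (R : realType) (n : nat) (X U : set 'rV[R]_n) : Prop :=
  forall V, zopen_in X V -> V !=set0 -> U `&` V !=set0.

Definition zirreducible (R : realType) (n : nat) (Z : set 'rV[R]_n) : Prop :=
  Z !=set0 /\
  forall F G, algebraic F -> algebraic G ->
    Z `<=` F `|` G -> Z `<=` F \/ Z `<=` G.

(* Z 0 < Z 1 < ... < Z d, irreducible closed subsets of A *)
Definition has_zchain (R : realType) (n : nat) (A : set 'rV[R]_n) (d : nat) :
    Prop :=
  exists Z : nat -> set 'rV[R]_n,
    (forall i, (i <= d)%N -> zclosed_in A (Z i) /\ zirreducible (Z i)) /\
    (forall i, (i < d)%N -> Z i `<` Z i.+1).

(* Krull dimension of the Zariski topology of A *)
Definition has_zdim (R : realType) (n : nat) (A : set 'rV[R]_n) (d : nat) :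
    Prop :=
  has_zchain A d /\ ~ has_zchain A d.+1.

(* dim_x X = d: the least dimension of a Zariski neighbourhood of x in X *)
Definition has_local_zdim (R : realType) (n : nat) (X : set 'rV[R]_n)
    (x : 'rV[R]_n) (d : nat) : Prop :=
  (exists U, [/\ zopen_in X U, U x & has_zdim U d]) /\
  (forall U, zopen_in X U -> U x -> has_zchain U d).

(* Zariski tangent space: the common kernel of the differentials at x of all
   the polynomials vanishing on X *)
Definition tangent_vector (R : realType) (n : nat) (X : set 'rV[R]_n)
    (x v : 'rV[R]_n) : Prop :=
  forall p, vanishing_ideal X p ->
    \sum_(i < n) peval (mpoly.mderiv i p) x * v ord0 i = 0.

Definition has_tangent_dim (R : realType) (n : nat) (X : set 'rV[R]_n)
    (x : 'rV[R]_n) (d : nat) : Prop :=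
  exists2 T : {vspace 'rV[R]_n},
    (forall v, v \in T <-> tangent_vector X x v) & \dim T = d.

(* dim T_x X = dim_x X, i.e. the local ring of X at x is regular *)
Definition nonsingular_at (R : realType) (n : nat) (X : set 'rV[R]_n)
    (x : 'rV[R]_n) : Prop :=
  exists2 d, has_local_zdim X x d & has_tangent_dim X x d.

Definition nonsingular (R : realType) (n : nat) (X : set 'rV[R]_n) : Prop :=
  forall x, X x -> nonsingular_at X x.

Definition algebraic_surface (R : realType) (n : nat) (X : set 'rV[R]_n) :
    Prop :=
  algebraic X /\ has_zdim X 2.

(* U is meant to be Zariski open in X. *)
Definition regular_on (R : realType) (n : nat) (U : set 'rV[R]_n)
    (f : 'rV[R]_n -> R) : Prop :=
  forall x, U x ->
    exists (V : set 'rV[R]_n) (p q : rpoly R n),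
      [/\ zopen_in U V, V x &
          forall y, V y -> peval q y != 0 /\ f y = peval p y / peval q y].

Definition continuous_rational (R : realType) (n : nat) (X : set 'rV[R]_n)
    (f : 'rV[R]_n -> R) : Prop :=
  {within X, continuous f} /\
  exists U, [/\ zopen_in X U, zdense_in X U & regular_on U f].

(* Main.v *)
(** On the Zariski dense open set where everything is regular, put
    [G_i = phi f_i / (f_1^2 + ... + f_r^2)].  From [phi = sum psi_j f_j] one gets
    [|G_i| <= sum |psi_j|], so [G_i] is a locally bounded rational function, and
    on a nonsingular surface such a function extends continuously off a finite
    set [S]: the local ring along a curve [C] is a discrete valuation ring, so
    there is no pole along [C].  If polynomials [p_j] interpolate the values of
    the [psi_j] on [S], then
    [phi - sum p_j f_j = sum (psi_j - p_j) f_j] has coefficients that vanish on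
    [S]; the corresponding quotients [G_i'] tend to [0] at the points of [S],
    hence extend to continuous rational functions, and
    [phi = sum (G_i' + p_i) f_i] by density.

    The dimension theory behind this is elementary.  At [x] with tangent
    dimension [d <= 2], equations [F] of [X] with independent gradients generate
    a regular local ring; that they generate the ideal of [X] near [x] follows
    from the chain condition, Krull's principal ideal theorem and the derivation
    [g |-> det d(F, h, g)], which cannot preserve an ideal that contains an
    element of finite order.  Density of Zariski open sets for the Euclidean
    topology comes from solving [F = h = 0, v = t] by a contraction. *)
Require Import Defs.
From HB Require Import structures.
From mathcomp Require Import all_boot all_order all_algebra.
From mathcomp Require Import all_classical all_reals all_analysis.
From mathcomp Require mpoly.
From mathcomp Require Import ring lra zify.
Set Implicit Arguments.
Unset Strict Implicit.
Unset Printing Implicit Defensive.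
Import Order.TTheory GRing.Theory Num.Theory.
Import numFieldNormedType.Exports.
Import (canonicals, coercions) mpoly.
Local Open Scope classical_set_scope.
Local Open Scope ring_scope.

(** * Ideals and noetherian rings *)

Section Ideals.
Variable A : comNzRingType.
Implicit Types (J I : set A) (s : seq A).

(** The quotients [phi f_i / (f_1^2 + ... + f_r^2)] come from the orthogonal projection of
    [(psi_1, ..., psi_r)] onto the line of [(f_1, ..., f_r)]; hence the bound. They can be
    discontinuous at isolated points: for [phi = x] and [f = (x, y)] they are [x^2 / (x^2 + y^2)]
    and [x y / (x^2 + y^2)]. Interpolation removes the defect because factors that stay bounded get
    multiplied by differences that tend to 0. Two obstacles shape the rest. [X] may have several
    components, some of dimension 0 or 1, and all the [f_i] may vanish on one of them, so quotients
    are taken with [x / 0 = 0] on a domain that records where the denominator is locally zero. And a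
    real zero set may have fewer points than its equations suggest, so counting equations does not
    give its dimension: nonsingularity must be converted into the statement that [F] generates the
    ideal of [X] locally before any argument with orders of vanishing. The local ring at a point is
    never formed; [loc] is its trace on polynomials, and identities between fractions hold up to a
    factor that is nonzero at the point. *)

Definition is_ideal J : Prop :=
  [/\ J 0, (forall x y, J x -> J y -> J (x + y)) & forall a x, J x -> J (a * x)].

Definition add_ideal J I : set A := [set x | exists2 y, I y & J (x - y)].

Definition adjoin J u : set A := [set x | exists c, J (x - c * u)].

(** A fold, so that [span (u :: s)] computes to [adjoin (span s) u]: later proofs pass silently
    between a list of generators and successive adjunctions. *)
Definition span s : set A := foldr (fun u J => adjoin J u) [set 0] s.

Definition noetherian := forall J, is_ideal J -> exists s, J = span s.

Lemma ideal0 J : is_ideal J -> J 0. Proof. by case. Qed.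

Lemma idealD J x y : is_ideal J -> J x -> J y -> J (x + y).
Proof. by case=> _ + _; apply. Qed.

Lemma idealMl J a x : is_ideal J -> J x -> J (a * x).
Proof. by case=> _ _; apply. Qed.

Lemma idealMr J a x : is_ideal J -> J x -> J (x * a).
Proof. by rewrite mulrC; apply: idealMl. Qed.

Lemma idealN J x : is_ideal J -> J x -> J (- x).
Proof. by rewrite -mulN1r; apply: idealMl. Qed.

Lemma idealB J x y : is_ideal J -> J x -> J y -> J (x - y).
Proof. by move=> hJ Jx Jy; apply: idealD => //; apply: idealN. Qed.

Lemma ideal_sum (I : finType) (P : pred I) J (F : I -> A) :
  is_ideal J -> (forall i, P i -> J (F i)) -> J (\sum_(i | P i) F i).
Proof.
move=> hJ JF; elim/big_ind: _ => //; first exact: ideal0.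
by move=> x y; apply: idealD.
Qed.

Lemma ideal_subl J x y : is_ideal J -> J (x - y) -> J y -> J x.
Proof. by move=> hJ /(idealD hJ) + /[dup] Jy => /(_ _ Jy); rewrite subrK. Qed.

Lemma ideal_subr J x y : is_ideal J -> J (x - y) -> J x -> J y.
Proof.
move=> hJ Jxy Jx; have := idealB hJ Jx Jxy; by rewrite opprB addrC subrK.
Qed.

Lemma add_ideal_ideal J I : is_ideal J -> is_ideal I -> is_ideal (add_ideal J I).
Proof.
move=> hJ hI; split.
- by exists 0; rewrite ?subr0; exact: ideal0.
- move=> x y [x' Ix Jx] [y' Iy Jy]; exists (x' + y'); first exact: idealD.
  have -> : x + y - (x' + y') = (x - x') + (y - y') by ring.
  exact: idealD.
- move=> a x [x' Ix Jx]; exists (a * x'); first exact: idealMl.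
  by rewrite -mulrBr; apply: idealMl.
Qed.

Lemma adjoin_ideal J u : is_ideal J -> is_ideal (adjoin J u).
Proof.
move=> hJ; split.
- by exists 0; rewrite mul0r subr0; exact: ideal0.
- move=> x y [c Jx] [d Jy]; exists (c + d).
  have -> : x + y - (c + d) * u = (x - c * u) + (y - d * u) by ring.
  exact: idealD.
- move=> a x [c Jx]; exists (a * c).
  have -> : a * x - a * c * u = a * (x - c * u) by ring.
  exact: idealMl.
Qed.

Lemma sub_adjoin J u x : J x -> adjoin J u x.
Proof. by move=> Jx; exists 0; rewrite mul0r subr0. Qed.

Lemma mem_adjoin J u : is_ideal J -> adjoin J u u.
Proof. by move=> hJ; exists 1; rewrite mul1r subrr; exact: ideal0. Qed.

Lemma adjoin_sub J I u : is_ideal I -> J `<=` I -> I u -> adjoin J u `<=` I.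
Proof.
move=> hI JI Iu x [c /JI Jx]; apply: ideal_subl Jx _ => //; exact: idealMl.
Qed.

Lemma adjoin_mono J I u : J `<=` I -> adjoin J u `<=` adjoin I u.
Proof. by move=> JI x [c Jx]; exists c; apply: JI. Qed.

Lemma span_ideal s : is_ideal (span s).
Proof.
elim: s => [|u s IHs] /=; last exact: adjoin_ideal.
by split=> //= [x y -> ->|a x ->]; rewrite ?addr0 ?mulr0.
Qed.

Lemma span_sub s J : is_ideal J -> (forall u, u \in s -> J u) -> span s `<=` J.
Proof.
move=> hJ; elim: s => [|u s IHs] /= hs; first by move=> x ->; exact: ideal0.
apply: adjoin_sub => //; last by apply: hs; rewrite mem_head.
by apply: IHs => w ws; apply: hs; rewrite inE ws orbT.
Qed.

Lemma mem_span s u : u \in s -> span s u.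
Proof.
elim: s => //= w s IHs; rewrite inE => /predU1P [->|us].
  exact/mem_adjoin/span_ideal.
exact/sub_adjoin/IHs.
Qed.

Lemma spanP s x :
  span s x <-> exists c : 'I_(size s) -> A, x = \sum_i c i * s`_i.
Proof.
split; last first.
  move=> [c ->]; apply: ideal_sum; first exact: span_ideal.
  by move=> i _; apply: idealMl; [exact: span_ideal|apply/mem_span/mem_nth].
elim: s x => [|u s IHs] x /=.
  by move=> ->; exists (fun=> 0); rewrite big_ord0.
move=> [d /IHs [c xE]].
exists (fun i => if unlift ord0 i is Some j then c j else d).
rewrite big_ord_recl unlift_none /=.
under eq_bigr do rewrite liftK /=.
by rewrite -xE addrC subrK.
Qed.

Lemma bigcup_chain_ideal (I : nat -> set A) :
  (forall k, is_ideal (I k)) -> (forall k, I k `<=` I k.+1) ->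
  is_ideal [set x | exists k, I k x].
Proof.
move=> hI Imono.
have Ile j k : (j <= k)%N -> I j `<=` I k.
  elim: k => [|k IHk]; first by rewrite leqn0 => /eqP ->.
  rewrite leq_eqVlt => /predU1P [-> //|/IHk jk]; exact: subset_trans (Imono k).
split.
- by exists 0%N; exact: ideal0.
- move=> x y [j Ix] [k Iy]; exists (maxn j k).
  by apply: idealD => //; [apply: Ile Ix|apply: Ile Iy]; rewrite ?leq_maxl ?leq_maxr.
- by move=> a x [k Ix]; exists k; exact: idealMl.
Qed.

Lemma noetherian_acc (I : nat -> set A) : noetherian ->
  (forall k, is_ideal (I k)) -> (forall k, I k `<=` I k.+1) ->
  exists N, forall k, I k `<=` I N.
Proof.
move=> nA hI Imono.
have Ile j k : (j <= k)%N -> I j `<=` I k.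
  elim: k => [|k IHk]; first by rewrite leqn0 => /eqP ->.
  rewrite leq_eqVlt => /predU1P [-> //|/IHk jk]; exact: subset_trans (Imono k).
have [s sE] := nA _ (bigcup_chain_ideal hI Imono).
have [N sN] : exists N, forall u, u \in s -> I N u.
  have : forall u, u \in s -> exists k, I k u.
    by move=> u us; have : span s u by [exact: mem_span]; rewrite -sE.
  elim: s {sE} => [|u s IHs] hs; first by exists 0%N.
  have [|N IN] := IHs; first by move=> w ws; apply: hs; rewrite inE ws orbT.
  have [|k Ik] := hs u; first by rewrite mem_head.
  exists (maxn k N) => w; rewrite inE => /predU1P [->|/IN].
    by apply: Ile Ik; exact: leq_maxl.
  by apply: Ile; exact: leq_maxr.
exists N => k x Ikx; have : span s x by rewrite -sE; exists k.
exact: span_sub.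
Qed.

Lemma noetherian_max (F : set (set A)) : noetherian ->
  (forall J, F J -> is_ideal J) -> F !=set0 ->
  exists2 J, F J & forall I, F I -> J `<=` I -> I `<=` J.
Proof.
move=> nA hF [J0 FJ0]; apply: contrapT => nomax.
have next (J : {J | F J}) : {I : {J | F J} | sval J `<=` sval I /\ ~ (sval I `<=` sval J)}.
  apply: cid; apply: contrapT => noI; apply: nomax.
  exists (sval J); first exact: svalP.
  move=> I FI JI; apply: contrapT => nIJ; apply: noI.
  by exists (exist _ I FI).
pose c k := iter k (fun J : {J | F J} => sval (next J)) (exist _ J0 FJ0).
have [||N cN] := noetherian_acc (I := fun k => sval (c k)) nA.
- by move=> k; apply: hF; exact: svalP.
- by move=> k; have [] := svalP (next (c k)).
- by have [_] := svalP (next (c N)); apply; exact: (cN N.+1).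
Qed.

End Ideals.

(** * Hilbert's basis theorem *)

Section HilbertBasis.
Variable A : comNzRingType.

(** Each [p] is multiplied by the power of ['X] that brings it to degree [d], so a combination of
    leading coefficients lifts to one of polynomials. *)
Lemma span_lead_coef (s : seq {poly A}) d a :
  (forall p, p \in s -> (size p <= d.+1)%N /\ p != 0) ->
  span (map lead_coef s) a ->
  exists2 g, span s g & (size g <= d.+1)%N /\ g`_d = a.
Proof.
elim: s a => [|p s IHs] a hs /=.
  by move=> ->; exists 0 => //; rewrite size_poly0 coef0.
move=> [c /IHs [|g sg [szg gd]]].
  by move=> q qs; apply: hs; rewrite inE qs orbT.
have [szp p0] := hs p (mem_head _ _).
exists (g + c%:P * 'X^(d.+1 - size p) * p).
  by exists (c%:P * 'X^(d.+1 - size p)); rewrite addrK.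
have szM : (size (c%:P * 'X^(d.+1 - size p) * p)%R <= d.+1)%N.
  rewrite -mulrA mul_polyC (leq_trans (size_scale_leq _ _)) //.
  rewrite mulrC size_mulXn // subnK //.
split; first by rewrite (leq_trans (size_polyD _ _)) // geq_max szg.
rewrite coefD gd -mulrA mul_polyC coefZ coefXnM ltnNge.
have sp0 : (0 < size p)%N by rewrite size_poly_gt0.
have le1 : (d.+1 - size p <= d)%N by lia.
rewrite le1 /= (_ : (d - (d.+1 - size p))%N = (size p).-1).
  by rewrite -lead_coefE subrK.
by lia.
Qed.

(** Elements of least degree are picked outside the span of the earlier ones. Once the ideals of
    leading coefficients are stationary, an element of the span lowers the degree of the next pick,
    against minimality. *)
Theorem noetherian_poly : noetherian A -> noetherian {poly A}.
Proof.
move=> nA J hJ; apply: contrapT => nofg.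
have next (s : seq {poly A}) : {p | (forall q, q \in s -> J q) ->
    [/\ J p, ~ span s p & forall q, J q -> ~ span s q -> (size p <= size q)%N]}.
  apply: cid; have [sJ|sJ] := pselect (forall q, q \in s -> J q); last by exists 0.
  have ex : exists k, `[< exists p, [/\ J p, ~ span s p & size p = k] >].
    apply: contrapT => nop; apply: nofg; exists s.
    rewrite eqEsubset; split; last exact: span_sub.
    move=> p Jp; apply: contrapT => nsp; apply: nop; exists (size p).
    by apply/asboolP; exists p.
  case: (ex_minnP ex) => k /asboolP [p [Jp nsp sp]] kmin.
  exists p => _; split=> // q Jq nsq; rewrite sp; apply: kmin.
  by apply/asboolP; exists q.
pose c k := iter k (fun s => sval (next s) :: s) [::].
have cJ k q : q \in c k -> J q.
  elim: k q => //= k IHk q; rewrite inE => /predU1P [->|/IHk //].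
  by have [] := svalP (next (c k)) IHk.
have cP k := svalP (next (c k)) (cJ k).
have csz k q : q \in c k -> (size q <= size (sval (next (c k))))%N.
  elim: k q => //= k IHk q.
  have [_ _ kmin] := cP k; have [Jk nsk _] := cP k.+1.
  have le : (size (sval (next (c k))) <= size (sval (next (c k.+1))))%N.
    apply: kmin => // sp; apply: nsk; exact: sub_adjoin.
  by rewrite inE => /predU1P [-> //|/IHk h]; exact: leq_trans le.
have c0 k q : q \in c k -> q != 0.
  elim: k q => //= k IHk q; rewrite inE => /predU1P [->|/IHk //].
  have [_ nsp _] := cP k; apply/eqP => p0; apply: nsp; rewrite p0.
  exact: (ideal0 (span_ideal _)).
have [||N cN] := noetherian_acc (I := fun k => span (map lead_coef (c k))) nA.
- by move=> k; exact: span_ideal.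
- by move=> k x; exact: sub_adjoin.
have [Jp nsp pmin] := cP N; set p := sval (next (c N)) in Jp nsp pmin.
have p0 : p != 0.
  by apply/eqP => p0; apply: nsp; rewrite p0; exact: (ideal0 (span_ideal _)).
have spp : (size p).-1.+1 = size p by rewrite prednK // size_poly_gt0.
have [||g sg [szg gd]] := @span_lead_coef (c N) (size p).-1 (lead_coef p).
- by move=> q qc; rewrite spp csz // (c0 N).
- by apply: (cN N.+1); exact/mem_adjoin/span_ideal.
have : (size p <= size (p - g)%R)%N.
  apply: pmin => [|spg].
    apply: idealB => //; apply: span_sub sg => //; exact: cJ.
  by apply: nsp; apply: ideal_subl spg sg; exact: span_ideal.
apply/negP; rewrite -ltnNge -spp ltnS.
apply/leq_sizeP => j; rewrite leq_eqVlt => /predU1P [<-|ltj].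
  by rewrite coefB gd lead_coefE subrr.
have szj (r : {poly A}) : (size r <= (size p).-1.+1)%N -> r`_j = 0.
  by move=> szr; rewrite nth_default // (leq_trans szr).
by rewrite coefB szj ?spp // szj // subrr.
Qed.

(** Generators of the preimage of an ideal map to generators. This carries the basis theorem from
    univariate polynomials to one more variable. *)
Lemma noetherian_surj (B : comNzRingType) (f : {rmorphism A -> B}) :
  (forall y, exists x, f x = y) -> noetherian A -> noetherian B.
Proof.
move=> fsurj nA J hJ.
have [|s sE] := nA (f @^-1` J).
  split=> /=; first by rewrite rmorph0; exact: ideal0.
    by move=> x y; rewrite rmorphD; exact: idealD.
  by move=> a x; rewrite rmorphM; exact: idealMl.
exists (map f s); rewrite eqEsubset; split; last first.
  apply: span_sub => // _ /mapP [x xs ->].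
  have : span s x by exact: mem_span.
  by rewrite -sE.
move=> y; have [x <-] := fsurj y; move=> Jx.
have : span s x by rewrite -sE.
move: x {Jx sE}; elim: s => [x -> /=|u s IHs x /= [c /IHs]].
  exact: rmorph0.
by rewrite rmorphB rmorphM; exists (f c).
Qed.

End HilbertBasis.

(** * Local algebra at a rational point *)

Section LocalAlgebra.
Variables (A : comNzRingType) (K : numFieldType) (ev : {rmorphism A -> K}).
Implicit Types (J I P : set A) (u v h q s : A).

(* The ideal generated by [J] in the local ring at [ev], contracted to [A]. *)
Definition loc J : set A := [set x | exists2 s, ev s != 0 & J (s * x)].

(* The product [m J], where [m] is the kernel of [ev]. *)
Definition max_mul J : set A :=
  [set z | forall I, is_ideal I ->
     (forall c y, ev c = 0 -> J y -> I (c * y)) -> I z].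

Lemma sub_loc J : J `<=` loc J.
Proof. by move=> x Jx; exists 1; rewrite ?mul1r ?rmorph1 ?oner_neq0. Qed.

Lemma loc_ideal J : is_ideal J -> is_ideal (loc J).
Proof.
move=> hJ; split; first exact: (sub_loc (ideal0 hJ)).
- move=> x y [s s0 Jx] [t t0 Jy]; exists (s * t); first by rewrite rmorphM mulf_neq0.
  have -> : s * t * (x + y) = t * (s * x) + s * (t * y) by ring.
  by apply: idealD => //; exact: idealMl.
- move=> a x [s s0 Jx]; exists s => //.
  by rewrite mulrCA; exact: idealMl.
Qed.

Lemma loc_mul J s x : is_ideal J -> ev s != 0 -> loc J (s * x) -> loc J x.
Proof.
move=> hJ s0 [t t0 Jx]; exists (t * s); first by rewrite rmorphM mulf_neq0.
by rewrite -mulrA.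
Qed.

Lemma loc_mono J I : J `<=` I -> loc J `<=` loc I.
Proof. by move=> JI x [s s0 /JI]; exists s. Qed.

Lemma loc_loc J : is_ideal J -> loc (loc J) `<=` loc J.
Proof. by move=> hJ x [s s0 /(loc_mul hJ s0)]. Qed.

Lemma loc_prime J P x : (forall y z, P (y * z) -> P y \/ P z) ->
  (forall y, P y -> ev y = 0) -> J `<=` P -> loc J x -> P x.
Proof.
by move=> Pp Pm JP [s s0 /JP /Pp [/Pm /eqP|//]]; rewrite (negPf s0).
Qed.

(** Finite generation of [I] gives a common denominator: a local inclusion of ideals holds on a
    whole Zariski neighbourhood of the point. *)
Lemma loc_uniform J I : noetherian A -> is_ideal J -> is_ideal I -> I `<=` loc J ->
  exists2 s, ev s != 0 & forall x, I x -> J (s * x).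
Proof.
move=> nA hJ hI IJ; have [t tE] := nA _ hI.
have [s s0 sJ] : exists2 s, ev s != 0 & forall x, x \in t -> J (s * x).
  have {}IJ x : x \in t -> loc J x by move=> xt; apply: IJ; rewrite tE; exact: mem_span.
  elim: t {tE} IJ => [|x t IHt] IJ.
    by exists 1; rewrite ?rmorph1 ?oner_neq0.
  have [|s s0 sJ] := IHt; first by move=> y yt; apply: IJ; rewrite inE yt orbT.
  have [|r r0 rJ] := IJ x; first by rewrite mem_head.
  exists (s * r); first by rewrite rmorphM mulf_neq0.
  move=> y; rewrite inE => /predU1P [->|/sJ Jy].
    by rewrite -mulrA; apply: idealMl.
  by rewrite (mulrC s) -mulrA; apply: idealMl.
exists s => // x; rewrite tE => tx.
have hI' : is_ideal [set y | J (s * y)].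
  split=> /=; first by rewrite mulr0; exact: ideal0.
    by move=> y z; rewrite mulrDr; exact: idealD.
  by move=> a y; rewrite mulrCA; exact: idealMl.
exact: (span_sub hI' sJ tx).
Qed.

Lemma max_mul_ideal J : is_ideal (max_mul J).
Proof.
split=> [I hI _|x y Jx Jy I hI h|a x Jx I hI h]; first exact: ideal0.
  by apply: idealD => //; [exact: Jx|exact: Jy].
by apply: idealMl => //; exact: Jx.
Qed.

Lemma mem_max_mul J c y : ev c = 0 -> J y -> max_mul J (c * y).
Proof. by move=> c0 Jy I _; apply. Qed.

Lemma max_mul_span (s : seq A) z : max_mul (span s) z ->
  exists2 c : 'I_(size s) -> A, (forall i, ev (c i) = 0) & z = \sum_i c i * s`_i.
Proof.
move=> /(_ [set z | exists2 c : 'I_(size s) -> A,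
  (forall i, ev (c i) = 0) & z = \sum_i c i * s`_i]); apply.
  split=> /=.
  - by exists (fun=> 0) => [i|]; rewrite ?rmorph0 // big1 // => i _; rewrite mul0r.
  - move=> _ _ [c c0 ->] [d d0 ->]; exists (fun i => c i + d i).
      by move=> i; rewrite rmorphD c0 d0 addr0.
    by rewrite -big_split; apply: eq_bigr => i _; rewrite mulrDl.
  - move=> a _ [c c0 ->]; exists (fun i => a * c i).
      by move=> i; rewrite rmorphM c0 mulr0.
    by rewrite mulr_sumr; apply: eq_bigr => i _; rewrite mulrA.
move=> c y c0 /spanP [d ->]; exists (fun i => c * d i).
  by move=> i; rewrite rmorphM c0 mul0r.
by rewrite mulr_sumr; apply: eq_bigr => i _; rewrite mulrA.
Qed.

(** The determinant trick: modulo [J] the generators of [I] are killed by a matrix [N] that is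
    diagonal with nonzero entries at the point, so [\det N] is a denominator for all of them. *)
Lemma nakayama J I : noetherian A -> is_ideal J -> is_ideal I ->
  (forall y, I y -> exists s z, [/\ ev s != 0, max_mul I z & J (s * y - z)]) ->
  I `<=` loc J.
Proof.
move=> nA hJ hI hIJ; have [t tE] := nA _ hI.
suff sJ (i : 'I_(size t)) : loc J t`_i.
  rewrite tE; apply: span_sub; first exact: loc_ideal.
  by move=> x /(nthP 0) [i lti <-]; exact: (sJ (Ordinal lti)).
have /choice [f fP] : forall i : 'I_(size t), exists sc : A * ('I_(size t) -> A),
    [/\ ev sc.1 != 0, forall j, ev (sc.2 j) = 0 &
        J (sc.1 * t`_i - \sum_j sc.2 j * t`_j)].
  move=> j; have [|s [z [s0 Iz Jsz]]] := hIJ t`_j.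
    by rewrite tE; apply: mem_span; exact: mem_nth.
  move: Iz; rewrite tE => /max_mul_span [c c0 zE].
  by exists (s, c); split=> //=; rewrite -zE.
pose N : 'M[A]_(size t) := \matrix_(j, k) ((f j).1 *+ (j == k) - (f j).2 k).
exists (\det N).
  rewrite -det_map_mx.
  have -> : map_mx ev N = diag_mx (\row_j ev (f j).1).
    apply/matrixP => j k; rewrite !mxE rmorphB rmorphMn /=.
    by have [_ -> _] := fP j; rewrite subr0.
  rewrite det_diag; apply/prodf_neq0 => j _; rewrite mxE.
  by have [] := fP j.
pose x : 'cV[A]_(size t) := \col_j t`_j.
have -> : \det N * t`_i = (\adj N *m (N *m x)) i ord0.
  by rewrite mulmxA mul_adj_mx mul_scalar_mx !mxE.
rewrite mxE; apply: ideal_sum => // j _; apply: idealMl => //.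
have [_ _] := fP j; congr (J _); rewrite mxE.
have -> : (f j).1 * t`_j = \sum_k (f j).1 *+ (j == k) * t`_k.
  rewrite (bigD1 j) //= eqxx mulr1n big1 ?addr0 // => k kj.
  by rewrite eq_sym (negPf kj) mul0r.
rewrite -sumrB; apply: eq_bigr => k _.
by rewrite !mxE mulrBl.
Qed.

(** The power [(u, v)^k] of the ideal [(u, v)]; coefficients are indexed by [nat] to avoid dependent
    indices. *)
Definition forms u v k : set A :=
  [set x | exists s : nat -> A, x = \sum_(i < k.+1) s i * (u ^+ i * v ^+ (k - i))].

Lemma forms_ideal u v k : is_ideal (forms u v k).
Proof.
split.
- by exists (fun=> 0); rewrite big1 // => i _; rewrite mul0r.
- move=> _ _ [s ->] [t ->]; exists (fun i => s i + t i).
  by rewrite -big_split; apply: eq_bigr => i _; rewrite mulrDl.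
- move=> a _ [s ->]; exists (fun i => a * s i).
  by rewrite mulr_sumr; apply: eq_bigr => i _; rewrite mulrA.
Qed.

Lemma mem_forms u v k i : (i <= k)%N -> forms u v k (u ^+ i * v ^+ (k - i)).
Proof.
rewrite -ltnS => ltik; exists (fun j => (j == i)%:R).
rewrite (bigD1 (Ordinal ltik)) //= eqxx mul1r big1 ?addr0 // => j ji.
by rewrite -val_eqE /= in ji; rewrite (negPf ji) mul0r.
Qed.

(* Krull's intersection theorem.  Take an ideal [Q] maximal among those that
   contain [L = J + m I] and meet the intersection [I] only inside [L]; the
   chain [Q : g^k] shows that every [g] in [m] has a power in [Q], whence
   [I <= Q] and [I <= L]. *)
Lemma krull_intersection J u v q : noetherian A -> is_ideal J ->
  ev u = 0 -> ev v = 0 ->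
  (forall k, loc (add_ideal J (forms u v k)) q) -> loc J q.
Proof.
move=> nA hJ u0 v0; pose I : set A := [set q | forall k, loc (add_ideal J (forms u v k)) q].
have hJk k : is_ideal (add_ideal J (forms u v k)).
  by apply: add_ideal_ideal => //; exact: forms_ideal.
have hI : is_ideal I.
  split=> [k|x y Ix Iy k|a x Ix k]; have hl := loc_ideal (hJk k).
  - exact: (ideal0 hl).
  - exact: (idealD hl (Ix k) (Iy k)).
  - exact: (idealMl _ hl (Ix k)).
pose L := add_ideal J (max_mul I).
have hL : is_ideal L by apply: add_ideal_ideal => //; exact: max_mul_ideal.
suff IL : I `<=` loc L.
  move=> Iq; apply: (@nakayama J I) Iq => // y /IL [s s0 [z Iz Jz]].
  by exists s, z.
have [|| Q [hQ LQ QI] Qmax] := @noetherian_max A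
    [set Q | [/\ is_ideal Q, L `<=` Q & Q `&` I `<=` L]] nA.
- by move=> Q [].
- by exists L; split=> // x [].
have nilp g : ev g = 0 -> exists N, Q (g ^+ N).
  move=> g0; have [|k x|N NQ] := @noetherian_acc A (fun k => [set c | Q (c * g ^+ k)]) nA.
  - move=> k; split=> /=; first by rewrite mul0r; exact: ideal0.
      by move=> x y; rewrite mulrDl; exact: idealD.
    by move=> a x; rewrite -mulrA; exact: idealMl.
  - by rewrite /= exprS mulrCA; exact: idealMl.
  exists N; apply: (Qmax (adjoin Q (g ^+ N))); last exact: mem_adjoin.
    split; first exact: adjoin_ideal.
      exact: subset_trans LQ (@sub_adjoin _ _ _).
    move=> y [[c Qc] Iy]; apply: QI; split=> //.
    have Lgy : Q (g * y).
      apply: LQ; exists (g * y); last by rewrite subrr; exact: ideal0.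
      exact: mem_max_mul.
    have Qcg : Q (c * g ^+ N.+1).
      have -> : c * g ^+ N.+1 = g * y - g * (y - c * g ^+ N).
        by rewrite exprS; ring.
      by apply: idealB => //; exact: idealMl.
    apply: ideal_subl Qc _ => //; exact: (NQ _ _ Qcg).
  exact: sub_adjoin.
have [M QM] := nilp u u0; have [N QN] := nilp v v0.
(* In degree [M + N] every monomial is divisible by [u ^+ M] or by [v ^+ N], hence lies in [Q]. *)
move=> y Iy; have [s s0 [z [c zE] Jz]] := Iy (M + N)%N.
exists s => //; apply: QI; split; last exact: (idealMl _ hI Iy).
apply: (ideal_subl hQ (y := z)).
  apply: LQ; exists 0; rewrite ?subr0 //; exact: (ideal0 (max_mul_ideal _)).
rewrite zE; apply: ideal_sum => // i _; apply: idealMl => //.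
have [leM|ltM] := leqP M i.
  by apply: idealMr => //; rewrite -(subnK leM) exprD; exact: idealMl.
have leN : (N <= M + N - i)%N by lia.
by apply: idealMl => //; rewrite -(subnK leN) exprD; exact: idealMl.
Qed.

(** By Krull's intersection theorem there is a last exponent [e] with [q] in [J + (g^e)] locally; a
    cofactor [t] in [J + (g)] would increase it. *)
Lemma adic_order J g q : noetherian A -> is_ideal J -> ev g = 0 -> ~ loc J q ->
  exists e s t, [/\ ev s != 0, J (s * q - t * g ^+ e) & ~ loc (adjoin J g) t].
Proof.
move=> nA hJ g0 nJq.
have hJk k : is_ideal (adjoin J (g ^+ k)) by exact: adjoin_ideal.
have ex : exists k, `[< ~ loc (adjoin J (g ^+ k)) q >].
  apply: contrapT => nex; apply: nJq; apply: (@krull_intersection _ 0 g) => //.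
    exact: rmorph0.
  move=> k; apply: contrapT => nk; apply: nex; exists k; apply/asboolP => lk.
  apply: nk; apply: loc_mono lk => x [c Jx]; exists (c * g ^+ k) => //.
  apply: idealMl; first exact: forms_ideal.
  by have := mem_forms 0 g (leq0n k); rewrite expr0 mul1r subn0.
case: (ex_minnP ex) => -[|e] /asboolP nle emin.
  by case: nle; apply: sub_loc; rewrite expr0; exists q; rewrite mulr1 subrr; exact: ideal0.
have [[s s0 [t Jst]]|nl] := pselect (loc (adjoin J (g ^+ e)) q); last first.
  have := emin e; rewrite ltnn => h.
  by have /h : `[< ~ loc (adjoin J (g ^+ e)) q >] by apply/asboolP.
exists e, s, t; split=> // -[r r0 [d Jd]]; apply: nle; exists (r * s).
  by rewrite rmorphM mulf_neq0.
exists d.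
have -> : r * s * q - d * g ^+ e.+1 = r * (s * q - t * g ^+ e) + g ^+ e * (r * t - d * g).
  by rewrite exprS; ring.
by apply: idealD => //; exact: idealMl.
Qed.

(** When [v] generates the maximal ideal modulo [J], the cofactor of [adic_order] is a unit. *)
Lemma dvr_order J v q : noetherian A -> is_ideal J -> ev v = 0 ->
  (forall x, ev x = 0 -> loc (adjoin J v) x) -> ~ loc J q ->
  exists e s w, [/\ ev s != 0, ev w != 0 & J (s * q - w * v ^+ e)].
Proof.
move=> nA hJ v0 hm /(adic_order nA hJ v0) [e [s [t [s0 Jst nt]]]].
exists e, s, t; split=> //; apply/eqP => t0; apply: nt; exact: hm.
Qed.

Lemma nat_nonroot (p : {poly K}) : p != 0 -> exists c : nat, p.[c%:R] != 0.
Proof.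
move=> p0; apply: contrapT => nc.
have := @max_poly_roots _ p [seq c%:R | c <- iota 0 (size p)] p0.
rewrite size_map size_iota ltnn => h; suff: false by []; apply: h.
  apply/allP => _ /mapP [c _ ->]; apply/rootP/eqP; apply: contrapT => /negP pc.
  by apply: nc; exists c.
rewrite map_inj_uniq ?iota_uniq // => x y /eqP.
by rewrite eqr_nat => /eqP.
Qed.

(* A leading form in [u, v] that does not vanish identically does not vanish
   in the direction [u = c v] for some natural number [c]. *)
Lemma regular_order J u v q : noetherian A -> is_ideal J -> ev u = 0 -> ev v = 0 ->
  (forall x, ev x = 0 -> loc (adjoin (adjoin J u) v) x) -> ~ loc J q ->
  exists c e s w, [/\ ev s != 0, ev w != 0 &
    adjoin J (u - c%:R * v) (s * q - w * v ^+ e)].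
Proof.
move=> nA hJ u0 v0 hm nJq.
have hJk k : is_ideal (add_ideal J (forms u v k)).
  by apply: add_ideal_ideal => //; exact: forms_ideal.
have ex : exists k, `[< ~ loc (add_ideal J (forms u v k)) q >].
  apply: contrapT => nex; apply: nJq; apply: (@krull_intersection _ u v) => // k.
  by apply: contrapT => nk; apply: nex; exists k; apply/asboolP.
case: (ex_minnP ex) => -[|e] /asboolP nle emin.
  case: nle; apply: sub_loc; exists q; last by rewrite subrr; exact: ideal0.
  have := idealMl q (forms_ideal u v 0) (mem_forms u v (leq0n 0)).
  by rewrite subn0 !expr0 !mulr1.
have [|nl] := pselect (loc (add_ideal J (forms u v e)) q); last first.
  have := emin e; rewrite ltnn => h.
  by have /h : `[< ~ loc (add_ideal J (forms u v e)) q >] by apply/asboolP.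
move=> [s s0 [_ [t ->] Jst]].
(* The leading form at [v = 1], with coefficients evaluated at the point. Were it zero, all [t i]
   would lie in [(u, v)] modulo [J], and [q] in the next power. *)
pose p : {poly K} := \poly_(i < e.+1) ev (t i).
have p0 : p != 0.
  apply/eqP => p0; apply: nle; apply: (loc_mul _ s0) => //.
  have hl := loc_ideal (hJk e.+1); apply: (ideal_subl hl).
    apply: sub_loc; exists 0; first exact: ideal0 (forms_ideal _ _ _).
    by rewrite subr0; exact: Jst.
  apply: ideal_sum => // i _.
  have : ev (t i) = 0 by have := coef_poly e.+1 (fun i => ev (t i)) i; rewrite ltn_ord -/p p0 coef0.
  move=> /hm [r r0 [b [a Jab]]]; apply: (loc_mul _ r0) => //; apply: sub_loc.
  have lei : (i <= e)%N by rewrite -ltnS.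
  exists (a * (u ^+ i.+1 * v ^+ (e.+1 - i.+1)) + b * (u ^+ i * v ^+ (e.+1 - i))).
    have hf := forms_ideal u v e.+1.
    by apply: idealD => //; apply: idealMl => //; apply: mem_forms; lia.
  rewrite subSS subSn // [v ^+ (e - i).+1]exprS [u ^+ i.+1]exprS.
  set ui := u ^+ i; set vi := v ^+ _.
  have -> : r * (t i * (ui * vi)) - (a * (u * ui * vi) + b * (ui * (v * vi))) =
    ui * vi * (r * t i - b * v - a * u) by ring.
  exact: idealMl.
have [c pc] := nat_nonroot p0.
exists c, e, s, (\sum_(i < e.+1) t i * c%:R ^+ i); split=> //.
  move: pc; rewrite horner_poly rmorph_sum /=.
  by under [in X in _ -> X]eq_bigr do rewrite rmorphM rmorphXn rmorph_nat.
have hA : is_ideal (adjoin J (u - c%:R * v)) by exact: adjoin_ideal.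
apply: (ideal_subl hA (y := \sum_(i < e.+1) t i * (u ^+ i * v ^+ (e - i)) -
    (\sum_(i < e.+1) t i * c%:R ^+ i) * v ^+ e)).
  by apply: sub_adjoin; rewrite opprB addrA subrK.
(* Modulo [u - c v], the monomial [u^i v^(e - i)] becomes [c^i v^e]. *)
rewrite mulr_suml -sumrB; apply: ideal_sum => // i _.
have lei : (i <= e)%N by rewrite -ltnS.
have -> : t i * (u ^+ i * v ^+ (e - i)) - t i * c%:R ^+ i * v ^+ e =
   t i * v ^+ (e - i) * (u ^+ i - (c%:R * v) ^+ i).
  have -> : v ^+ e = v ^+ (e - i) * v ^+ i by rewrite -exprD subnK.
  by rewrite exprMn; ring.
by apply: idealMl => //; rewrite subrXX; apply: idealMr => //; exact: mem_adjoin.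
Qed.

(** Properness is kept apart: it is either a separate hypothesis or comes from a point at which all
    members vanish. *)
Definition is_prime P := is_ideal P /\ (forall x y, P (x * y) -> P x \/ P y).

Lemma prime_exp P x k : is_prime P -> ~ P 1 -> P (x ^+ k) -> P x.
Proof.
move=> [hP Pp] P1; elim: k => [//|k IHk]; rewrite exprS => /Pp [//|]; exact: IHk.
Qed.

(* Krull's principal ideal theorem, for the chain [PY < PT < m] in a regular
   local ring with parameters [h, v]. *)
Lemma height_le2 J PY PT h v e s w q z : noetherian A -> is_ideal J ->
  is_prime PY -> is_prime PT -> J `<=` PY -> PY `<=` PT ->
  (forall x, PT x -> ev x = 0) -> ev h = 0 -> ev z = 0 -> ~ PT z ->
  (forall x, ev x = 0 -> loc (adjoin (adjoin J h) v) x) ->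
  ev w != 0 -> adjoin J h (s * q - w * v ^+ e) -> PY q ->
  PT `<=` PY.
Proof.
move=> nA hJ [hY pY] [hT pT] JY YT Tm h0 z0 nTz hm w0 Jw Yq t Tt; apply: contrapT => nYt.
have nTu x : ev x != 0 -> ~ PT x by move=> x0 /Tm /eqP; rewrite (negPf x0).
have nT1 : ~ PT 1 by apply: nTu; rewrite rmorph1 oner_neq0.
(* Otherwise [PT] would contain [h], then [v] by the relation [Jw], hence the whole maximal ideal
   and [z]. *)
have nTh : ~ PT h.
  move=> Th; apply: nTz.
  have sAT : adjoin J h `<=` PT by apply: adjoin_sub => //; exact: subset_trans YT.
  have Tv : PT v.
    apply: (@prime_exp _ _ e) => //.
    have : PT (w * v ^+ e).
      by apply: (ideal_subr hT (sAT _ Jw)); apply: idealMl => //; exact: YT.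
    by move=> /pT [/nTu|//]; case.
  apply: (loc_prime pT Tm _ (hm z z0)).
  exact: adjoin_sub.
(* The ideal [PY + (t^k)] localised at [PT] and contracted, in the role of a symbolic power.
   Elements outside [PT], such as [h], can be cancelled in it. *)
pose I k : set A := [set y | exists2 r, ~ PT r & exists c, PY (r * y - c * t ^+ k)].
have hI k : is_ideal (I k).
  split.
  - by exists 1 => //; exists 0; rewrite mulr0 mul0r subrr; exact: ideal0.
  - move=> x y [r Tr [c Yc]] [r' Tr' [c' Yc']]; exists (r * r'); first by move=> /pT [].
    exists (r' * c + r * c').
    have -> : r * r' * (x + y) - (r' * c + r * c') * t ^+ k =
      r' * (r * x - c * t ^+ k) + r * (r' * y - c' * t ^+ k) by ring.
    by apply: idealD => //; exact: idealMl.
  - move=> a x [r Tr [c Yc]]; exists r => //; exists (a * c).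
    have -> : r * (a * x) - a * c * t ^+ k = a * (r * x - c * t ^+ k) by ring.
    exact: idealMl.
have YI k : PY `<=` I k.
  by move=> x Yx; exists 1 => //; exists 0; rewrite mul1r mul0r subr0.
have Idec k : I k.+1 `<=` I k.
  by move=> x [r Tr [c Yc]]; exists r => //; exists (c * t); rewrite -mulrA -exprS.
have Ih k x : I k (x * h) -> I k x.
  move=> [r Tr [c Yc]]; exists (r * h); first by move=> /pT [].
  by exists c; rewrite -mulrA (mulrC h).
have hIh k : is_ideal (adjoin (I k) h) by exact: adjoin_ideal.
have JIh k : adjoin J h `<=` adjoin (I k) h.
  by apply: adjoin_mono => x /JY; exact: YI.
(* Modulo [J + (h)] the maximal ideal is generated by [v], so the least power of [v] in [I k + (h)]
   measures the length of the quotient; [e] bounds it for all [k]. *)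
have ex k : exists j, `[< loc (adjoin (I k) h) (v ^+ j) >].
  exists e; apply/asboolP; exists w => //; apply: (ideal_subr (hIh k) (JIh _ _ Jw)).
  by apply: idealMl => //; apply: sub_adjoin; exact: YI.
pose j k := ex_minn (ex k).
have jP k : loc (adjoin (I k) h) (v ^+ j k).
  by rewrite /j; case: ex_minnP => ? /asboolP.
have jmin k i : loc (adjoin (I k) h) (v ^+ i) -> (j k <= i)%N.
  by rewrite /j; case: ex_minnP => ? _ + li; apply; apply/asboolP.
have [N jN] : exists N, (j N.+1 <= j N)%N.
  apply: contrapT => nN.
  have jlt k : (k <= j k)%N.
    elim: k => // k IHk; apply: leq_ltn_trans IHk _; rewrite ltnNge.
    by apply/negP => h'; apply: nN; exists k.
  have := jlt e.+1; rewrite leqNgt ltnS jmin //.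
  exists w => //; apply: (ideal_subr (hIh _) (JIh _ _ Jw)).
  by apply: idealMl => //; apply: sub_adjoin; exact: YI.
(* Equal lengths force equality modulo [h]: an element of [I N] of order [i < j N] in [v] would put
   [v ^+ i] into [I N + (h)]. *)
have INI' y : I N y -> loc (adjoin (I N.+1) h) y.
  move=> Iy.
  have hl := loc_ideal (hIh N.+1).
  have step i : (i <= j N)%N -> loc (adjoin (adjoin (I N.+1) h) (v ^+ i)) y.
    elim: i => [_|i IHi ltij].
      by apply: sub_loc; exists y; rewrite expr0 mulr1 subrr; exact: ideal0.
    have [r r0 [c Jc]] := IHi (ltnW ltij).
    have [c0|c0] := eqVneq (ev c) 0; last first.
      have : loc (adjoin (I N) h) (v ^+ i).
        exists c => //; apply: (ideal_subr (hIh N) (x := r * y)).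
          exact: (adjoin_mono (Idec N) Jc).
        by apply: sub_adjoin; exact: idealMl.
      by move=> /jmin; rewrite leqNgt ltij.
    have [r' r'0 [c' Jc']] := hm c c0; exists (r * r'); first by rewrite rmorphM mulf_neq0.
    exists c'; have -> : r * r' * y - c' * v ^+ i.+1 =
      r' * (r * y - c * v ^+ i) + v ^+ i * (r' * c - c' * v).
      by rewrite exprS; ring.
    by apply: idealD => //; apply: idealMl => //; exact: JIh.
  have [r r0 [c Jc]] := step _ (leqnn _).
  apply: (loc_mul (hIh _) r0); apply: (ideal_subl hl).
    exact: (sub_loc Jc).
  apply: idealMl => //.
  by rewrite -(subnK jN) exprD; apply: idealMl => //; exact: jP.
(* Since [h] can be cancelled in [I N], the previous inclusion becomes [I N <= I N.+1 + h I N]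
   locally. *)
have : I N `<=` loc (I N.+1).
  apply: nakayama => // y Iy; have [r r0 [c Jc]] := INI' y Iy.
  exists r, (h * c); split=> //; last by rewrite (mulrC h).
  apply: mem_max_mul => //.
  apply: Ih; apply: (ideal_subr (hI N) (Idec _ _ Jc)); exact: idealMl.
(* The outcome reads [t^N (r' r - c t) = 0] modulo [PY]: then [t] lies in [PY] or [r' r] in [PT],
   and both are excluded. *)
have : I N (t ^+ N).
  by exists 1 => //; exists 1; rewrite !mul1r subrr; exact: ideal0.
move=> tN /(_ _ tN) [r r0 [r' Tr' [c Yc]]].
have : PY (t ^+ N * (r' * r - c * t)).
  by move: Yc; congr (PY _); rewrite exprS; ring.
move=> /pY [Yt|Yc'].
  apply: nYt; apply: prime_exp Yt; first by split.
  by move=> /YT.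
have : PT (r' * r).
  apply: (ideal_subl hT (YT _ Yc')); exact: idealMl.
by move=> /pT [//|]; exact: nTu.
Qed.

Definition is_derivation (E : A -> A) :=
  (forall x y, E (x + y) = E x + E y) /\
  (forall x y, E (x * y) = E x * y + x * E y).

Lemma derivation_exp E v k : is_derivation E ->
  E (v ^+ k.+1) = k.+1%:R * E v * v ^+ k.
Proof.
move=> [_ EM]; elim: k => [|k IHk]; first by rewrite expr1 expr0 mul1r mulr1.
rewrite exprS EM IHk exprS -[k.+2%:R]natr1; ring.
Qed.

(** Only the lowest power of [v] is tracked: each application of [E] lowers it by one and brings
    down the exponent and a factor [E v]. *)
Lemma derivation_iter E v w k j : is_derivation E -> (j <= k)%N ->
  exists c, iter j E (w * v ^+ k) =
    (k ^_ j)%:R * w * E v ^+ j * v ^+ (k - j) + c * v ^+ (k - j).+1.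
Proof.
move=> hE; have [ED EM] := hE.
elim: j => [_|j IHj ltjk].
  by exists 0; rewrite ffactn0 mul1r expr0 mulr1 subn0 mul0r addr0.
have [c cE] := IHj (ltnW ltjk); rewrite iterS cE ffactnSr -subnSK //.
set m := (k - j.+1)%N; set a := (k ^_ j)%:R * w * E v ^+ j.
exists (E a + E c * v + c * m.+2%:R * E v).
rewrite ED EM (derivation_exp _ _ hE) [E (c * _)]EM (derivation_exp _ _ hE).
rewrite /a natrM !exprS; ring.
Qed.

(* The [e]-th derivative of [q] does not vanish at the point, so an ideal
   through the point that contains [q] cannot be stable. *)
Lemma derivation_unstable E J I v e s w q : is_derivation E -> is_ideal I ->
  (forall x, J x -> J (E x)) -> (forall x, J x -> ev x = 0) ->
  (forall x, I x -> ev x = 0) -> ev v = 0 -> ev (E v) != 0 -> ev w != 0 ->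
  J (s * q - w * v ^+ e) -> I q ->
  exists2 g, I g & ~ I (E g).
Proof.
move=> hE hI JE Jm Im v0 Ev0 w0 Jq Iq; apply: contrapT => stab.
have IE x : I x -> I (E x).
  by move=> Ix; apply: contrapT => nIx; apply: stab; exists x.
have [ED EM] := hE.
have iterD k x y : iter k E (x + y) = iter k E x + iter k E y.
  by elim: k => //= k ->; rewrite ED.
have /Im sq0 : I (iter e E (s * q)).
  elim: e {Jq} => [|k IHk] /=; [exact: idealMl|exact: IE].
have /Jm sqw0 : J (iter e E (s * q - w * v ^+ e)).
  by elim: {1}e => [//|k IHk] /=; exact: JE.
(* What survives at the point is [e! w (E v)^e], nonzero in characteristic 0. *)
have [c cE] := derivation_iter v w hE (leqnn e).
move: sq0; rewrite -[s * q](subrK (w * v ^+ e)) iterD rmorphD sqw0 add0r cE.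
rewrite subnn expr0 mulr1 rmorphD !rmorphM rmorph_nat !rmorphXn v0 expr1 mulr0 addr0.
move/eqP; rewrite ffactnn !mulf_eq0 (negPf w0) orbF expf_eq0 (negPf Ev0) andbF orbF.
by rewrite pnatr_eq0 eqn0Ngt fact_gt0.
Qed.

End LocalAlgebra.

(** * Polynomials, Hadamard's lemma and Jacobian derivations *)

Section Polynomials.
Variables (R : realType) (n : nat).
Local Notation P := (mpoly.mpoly n R).
Local Notation "'X_ i" := (mpoly.mpolyX R (mpoly.mnm1 i)) (at level 8, i at level 2).
Local Notation "c %:C" := (mpoly.mpolyC n c) (at level 2, format "c %:C").
Implicit Types (a : 'rV[R]_n) (p q : P) (s : seq P).

Lemma mpoly_ring_ind (Q : P -> Prop) :
  (forall c : R, Q c%:C) -> (forall i, Q 'X_i) ->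
  (forall p q, Q p -> Q q -> Q (p + q)) ->
  (forall p q, Q p -> Q q -> Q (p * q)) -> forall p, Q p.
Proof.
move=> QC QX QD QM p; elim/mpoly.mpolyind: p => [|c m p _ _ Qp].
  by rewrite -(mpoly.mpolyC0 n R).
apply: QD => //; rewrite -mpoly.mul_mpolyC; apply: (QM) => //.
rewrite mpoly.mpolyXE_id; elim/big_ind: _ => [|x y|i _].
- by rewrite -(mpoly.mpolyC1 n R).
- exact: QM.
elim: (mpoly.fun_of_multinom m i) => [|k IHk].
  by rewrite expr0 -(mpoly.mpolyC1 n R).
by rewrite exprS; apply: (QM).
Qed.

Definition evalat a : {rmorphism P -> R} := mpoly.meval (fun i => a ord0 i).

Lemma evalatE a p : evalat a p = peval p a. Proof. by []. Qed.

Definition coordat a (i : 'I_n) : P := 'X_i - (a ord0 i)%:C.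

Lemma peval_coordat a b i : peval (coordat a i) b = b ord0 i - a ord0 i.
Proof. by rewrite /peval mpoly.mevalB mpoly.mevalXU mpoly.mevalC. Qed.

Lemma mderiv_coordat a i j : mpoly.mderiv j (coordat a i) = (i == j)%:R%:C.
Proof.
rewrite /coordat mpoly.mderivB mpoly.mderivC subr0 mpoly.mderivX.
rewrite mpoly.mnm1E; case: eqP => [->|_]; last by rewrite scale0r mpoly.mpolyC0.
rewrite scale1r mpoly.mpolyC1 -mpoly.mpolyX0; congr (mpoly.mpolyX R _).
by apply/mpoly.mnmP => k; rewrite mpoly.mnmBE subnn mpoly.mnm0E.
Qed.

Lemma hadamard a p : exists c : 'I_n -> P,
  p - (peval p a)%:C = \sum_i c i * coordat a i.
Proof.
elim/mpoly_ring_ind: p => [c|i|p q [c cE] [d dE]|p q [c cE] [d dE]].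
- exists (fun=> 0); rewrite /peval mpoly.mevalC subrr big1 // => i _.
  by rewrite mul0r.
- exists (fun j => (j == i)%:R); rewrite (bigD1 i) //= eqxx mul1r big1 ?addr0.
    by rewrite /peval mpoly.mevalXU.
  by move=> j /negPf ->; rewrite mul0r.
- exists (fun i => c i + d i); under eq_bigr do rewrite mulrDl.
  by rewrite big_split /= -cE -dE -!evalatE rmorphD mpoly.mpolyCD opprD addrACA.
- exists (fun i => q * c i + (peval p a)%:C * d i).
  under eq_bigr do rewrite mulrDl -!mulrA.
  rewrite big_split /= -!mulr_sumr -cE -dE -!evalatE rmorphM mpoly.mpolyCM; ring.
Qed.

Definition grad p a : 'rV[R]_n := \row_i peval (mpoly.mderiv i p) a.

Lemma hadamard_grad a p (c : 'I_n -> P) :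
  p - (peval p a)%:C = \sum_i c i * coordat a i -> forall j, peval (c j) a = grad p a ord0 j.
Proof.
move=> pE j; rewrite mxE; have := congr1 (fun q => peval (mpoly.mderiv j q) a) pE.
rewrite mpoly.mderivB mpoly.mderivC subr0 => ->.
apply: esym; rewrite raddf_sum /= -evalatE rmorph_sum /= (bigD1 j) //= big1.
  rewrite addr0 mpoly.mderivM rmorphD !rmorphM /= !evalatE.
  rewrite peval_coordat subrr mulr0 add0r mderiv_coordat eqxx.
  by rewrite /peval mpoly.mevalC mulr1.
move=> i ij; rewrite mpoly.mderivM rmorphD !rmorphM /= !evalatE.
rewrite peval_coordat subrr mulr0 add0r mderiv_coordat (negPf ij).
by rewrite /peval mpoly.mevalC mulr0.
Qed.

Definition jacobian s : 'M[P]_n := \matrix_(i, j) mpoly.mderiv j s`_i.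

Definition params a s :=
  [/\ size s = n, forall p, p \in s -> peval p a = 0 &
      peval (\det (jacobian s)) a != 0].

Lemma jacobian_free a s : size s = n ->
  (peval (\det (jacobian s)) a != 0) = free [seq grad p a | p <- s].
Proof.
move=> szs; rewrite -evalatE -det_map_mx.
have szt : size [seq grad p a | p <- s] == n by rewrite size_map szs.
have rowE (i : 'I_n) : row i (map_mx (evalat a) (jacobian s)) = (Tuple szt)`_i.
  rewrite /= (nth_map 0) ?szs //; apply/rowP => j; by rewrite !mxE.
have mulE (k : 'rV[R]_n) : k *m map_mx (evalat a) (jacobian s) =
    \sum_(i < n) k ord0 i *: (Tuple szt)`_i.
  by rewrite mulmx_sum_row; apply: eq_bigr => i _; rewrite rowE.
rewrite -unitfE -unitmxE; apply/idP/idP => [u|/(@freeP _ _ _ (Tuple szt)) fr].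
  apply/(@freeP _ _ _ (Tuple szt)) => k k0 i.
  have : (\row_j k j) *m map_mx (evalat a) (jacobian s) = 0.
    by rewrite mulE -[RHS]k0; apply: eq_bigr => j _; rewrite mxE.
  move/(congr1 (mulmx^~ (invmx (map_mx (evalat a) (jacobian s))))).
  by rewrite mulmxK // mul0mx => /rowP /(_ i); rewrite !mxE.
rewrite -row_free_unit -kermx_eq0; apply/eqP/row_matrixP => i; rewrite row0.
have /sub_kermxP := row_sub i (kermx (map_mx (evalat a) (jacobian s))).
rewrite mulE => /fr k0; apply/rowP => j; by rewrite k0 mxE.
Qed.

Lemma params_perm a s t : perm_eq s t -> params a s -> params a t.
Proof.
move=> st [szs s0 jac]; have szt : size t = n by rewrite -(perm_size st).
split; [exact: szt|by move=> p; rewrite -(perm_mem st); exact: s0|].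
rewrite jacobian_free // -(@perm_free _ _ [seq grad p a | p <- s]).
  by rewrite -jacobian_free.
exact: perm_map.
Qed.

(** Cramer's rule: Hadamard's lemma writes [s] as [C] times the coordinates centred at [a], and [C]
    equals the Jacobian matrix at [a], so [\det C] is a denominator. *)
Lemma params_max a s p : params a s -> peval p a = 0 ->
  loc (evalat a) (span s) p.
Proof.
move=> [szs s0 jac] p0.
have hs := span_ideal s; have hl := loc_ideal (evalat a) hs.
suff lc j : loc (evalat a) (span s) (coordat a j).
  have [c] := hadamard a p; rewrite p0 mpoly.mpolyC0 subr0 => ->.
  by apply: ideal_sum => // i _; apply: idealMl.
have /choice [c cE] : forall i : 'I_n, exists c : 'I_n -> P,
    s`_i = \sum_j c j * coordat a j.
  move=> i; have [c] := hadamard a s`_i.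
  rewrite s0 ?mem_nth ?szs // mpoly.mpolyC0 subr0 => E; by exists c.
pose C : 'M[P]_n := \matrix_(i, j) c i j.
exists (\det C).
  rewrite -det_map_mx; suff -> : map_mx (evalat a) C = map_mx (evalat a) (jacobian s).
    by rewrite det_map_mx.
  apply/matrixP => i k; rewrite !mxE evalatE (@hadamard_grad a s`_i) ?mxE //.
  by rewrite s0 ?mem_nth ?szs // mpoly.mpolyC0 subr0.
have -> : \det C * coordat a j = (\adj C *m (C *m \col_k coordat a k)) j ord0.
  by rewrite mulmxA mul_adj_mx mul_scalar_mx !mxE.
rewrite mxE; apply: ideal_sum => // i _; apply: idealMl => //.
rewrite mxE (_ : \sum__ _ = s`_i); first by apply/mem_span/mem_nth; rewrite szs.
by rewrite cE; apply: eq_bigr => k _; rewrite !mxE.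
Qed.

(** Differentiation along the curves on which the members of [t] are constant. It kills [t], as two
    rows coincide, and so preserves [span t]. *)
Definition jacobian_derivation t g : P := \det (jacobian (rcons t g)).

Lemma jacobian_derivationE t (i0 : 'I_n) g : size t = i0 -> i0.+1 = n ->
  jacobian_derivation t g =
  \sum_j mpoly.mderiv j g * cofactor (jacobian t) i0 j.
Proof.
move=> szt i0n; rewrite /jacobian_derivation (expand_det_row _ i0).
apply: eq_bigr => j _.
have -> : jacobian (rcons t g) i0 j = mpoly.mderiv j g.
  by rewrite mxE nth_rcons szt ltnn eqxx.
apply: (congr1 (fun z => mpoly.mderiv j g * z)); rewrite /cofactor.
apply: (congr1 (fun N => _ * \det N)); apply/matrixP => k l; rewrite !mxE.
rewrite nth_rcons szt; have := neq_lift i0 k; rewrite -val_eqE /= => ne.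
have := ltn_ord (lift i0 k); rewrite -[X in (_ < X)%N]i0n ltnS leq_eqVlt eq_sym.
by rewrite (negPf ne) /= => ->.
Qed.

Lemma jacobian_derivationP t : (size t).+1 = n -> is_derivation (jacobian_derivation t).
Proof.
move=> szt; have i0n : (size t < n)%N by exact: eq_leq.
have E g := @jacobian_derivationE t (Ordinal i0n) g erefl szt.
split=> x y; rewrite !E.
  by rewrite -big_split; apply: eq_bigr => j _; rewrite mpoly.mderivD mulrDl.
rewrite mulr_suml mulr_sumr -big_split; apply: eq_bigr => j _ /=.
rewrite mpoly.mderivM; ring.
Qed.

Lemma jacobian_derivation_span t x : (size t).+1 = n ->
  span t x -> span t (jacobian_derivation t x).
Proof.
move=> szt /spanP [c ->].
have i0n : (size t < n)%N by exact: eq_leq.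
have [ED EM] := jacobian_derivationP szt.
have ht := span_ideal t.
have E0 : jacobian_derivation t 0 = 0.
  by apply: (addrI (jacobian_derivation t 0)); rewrite -ED !addr0.
rewrite (big_morph _ ED E0); apply: ideal_sum => // i _; rewrite EM.
have ti : t`_i \in t by exact: mem_nth.
apply: idealD => //; first by apply: idealMl => //; exact: mem_span.
suff -> : jacobian_derivation t t`_i = 0 by rewrite mulr0; exact: ideal0.
have lti : (i < n)%N by exact: ltn_trans i0n.
apply: (@determinant_alternate _ _ _ (Ordinal lti) (Ordinal i0n)).
  by rewrite -val_eqE /= ltn_eqF.
move=> j; rewrite !mxE !nth_rcons /= ltnn eqxx.
by rewrite ltn_ord.
Qed.

(** A nonzero derivative makes [g] a further parameter beside [F]. As [h] need not vanish at [b],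
    its value is subtracted, which leaves the Jacobian matrix unchanged. *)
Lemma jacobian_derivation_params b h g (F : seq P) : (size F).+2 = n ->
  (forall p, p \in g :: F -> peval p b = 0) ->
  peval (jacobian_derivation (h :: F) g) b != 0 ->
  params b [:: h - mpoly.mpolyC n (peval h b), g & F].
Proof.
move=> szF gF Eb; set v := h - _.
have v0 : peval v b = 0 by rewrite /v /peval mpoly.mevalB mpoly.mevalC subrr.
apply: (@params_perm _ (rcons (v :: F) g)).
  by rewrite perm_rcons (perm_catCA [:: g] [:: v] F).
split.
- by rewrite size_rcons.
- move=> p; rewrite mem_rcons !inE => /or3P [/eqP ->|/eqP -> //|pF].
    by apply: gF; rewrite mem_head.
  by apply: gF; rewrite inE pF orbT.
- suff -> : jacobian (rcons (v :: F) g) = jacobian (rcons (h :: F) g) by [].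
  apply/matrixP => -[[|j] ltj] l; rewrite !mxE //=.
  by rewrite /v mpoly.mderivB mpoly.mderivC subr0.
Qed.

End Polynomials.

Lemma noetherian_field (K : fieldType) : noetherian K.
Proof.
move=> J hJ; have [[x [Jx x0]]|J0] := pselect (exists x, J x /\ x != 0).
  exists [:: 1]; rewrite eqEsubset; split=> y _.
    by exists y => /=; rewrite mulr1 subrr.
  by rewrite -[y](divfK x0); exact: idealMl.
exists [::]; rewrite eqEsubset; split=> [y Jy|_ ->]; last exact: ideal0.
by apply: contrapT => /eqP y0; apply: J0; exists y.
Qed.

Theorem noetherian_mpoly (R : realType) n : noetherian (mpoly.mpoly n R).
Proof.
elim: n => [|n IHn].
  pose f0 : {rmorphism R -> mpoly.mpoly 0 R} := @mpoly.mpolyC 0 R.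
  apply: (@noetherian_surj _ _ f0 _ (@noetherian_field R)).
  by move=> p; exists (mpoly.mcoeff mpoly.mnm0 p); rewrite [RHS]mpoly.nvar0_mpolyC.
pose f : {rmorphism {poly mpoly.mpoly n R} -> mpoly.mpoly n.+1 R} :=
  (horner_eval (mpoly.mpolyX R (mpoly.mnm1 ord_max))) \o
   (map_poly (@mpoly.mwiden n R)).
apply: (@noetherian_surj _ _ f _ (noetherian_poly IHn)) => p.
elim/mpoly_ring_ind: p => [c|i|_ _ [x <-] [y <-]|_ _ [x <-] [y <-]].
- exists (mpoly.mpolyC n c)%:P.
  by rewrite /f /= /horner_eval map_polyC /= hornerC mpoly.mwidenC.
- have [ltin|leni] := ltnP i n.
    exists (mpoly.mpolyX R (mpoly.mnm1 (Ordinal ltin)))%:P.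
    rewrite /f /= /horner_eval map_polyC /= hornerC mpoly.mwidenX.
    congr (mpoly.mpolyX R _); rewrite mpoly.mnmwiden1; congr (mpoly.mnm1 _).
    exact: val_inj.
  exists 'X; rewrite /f /= /horner_eval map_polyX hornerX.
  congr (mpoly.mpolyX R (mpoly.mnm1 _)); apply: val_inj => /=.
  by apply/eqP; rewrite eqn_leq leni -ltnS ltn_ord.
- by exists (x + y); rewrite rmorphD.
- by exists (x * y); rewrite rmorphM.
Qed.

(** * Algebraic sets and irreducible components *)

Section Varieties.
Variables (R : realType) (n : nat).
Local Notation P := (mpoly.mpoly n R).
Implicit Types (a x : 'rV[R]_n) (p q : P) (s : seq P) (X Y Z : set 'rV[R]_n).

Lemma vanishing_ideal_ideal X : is_ideal (vanishing_ideal X : set P).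
Proof.
split=> [a _|p q Xp Xq a Xa|p q Xq a Xa]; first exact: (rmorph0 (evalat a)).
  by rewrite -evalatE rmorphD /= !evalatE Xp ?Xq ?addr0.
by rewrite -evalatE rmorphM /= !evalatE Xq ?mulr0.
Qed.

Lemma vanishing_ideal_sub X Y : X `<=` Y -> vanishing_ideal Y `<=` vanishing_ideal X.
Proof. by move=> XY p Yp a /XY; exact: Yp. Qed.

Lemma zeros_vanishing_ideal X : algebraic X -> zeros (vanishing_ideal X) = X.
Proof.
move=> [S ->]; rewrite eqEsubset; split=> a ha p; last exact.
by move=> Sp; apply: ha => b; apply.
Qed.

Lemma algebraicI X Y : algebraic X -> algebraic Y -> algebraic (X `&` Y).
Proof.
move=> [S ->] [T ->]; exists (S `|` T); rewrite eqEsubset; split=> a.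
  by move=> [Sa Ta] p [/Sa|/Ta].
by move=> h; split=> p hp; apply: h; [left|right].
Qed.

Lemma algebraicU X Y : algebraic X -> algebraic Y -> algebraic (X `|` Y).
Proof.
move=> [S ->] [T ->].
exists [set r | exists p q, [/\ S p, T q & r = p * q]]; rewrite eqEsubset; split=> a.
  move=> h _ [p [q [Sp Tq ->]]]; rewrite -evalatE rmorphM /= !evalatE.
  by case: h => [/(_ p Sp) ->|/(_ q Tq) ->]; rewrite ?mul0r ?mulr0.
move=> h; have [Sa|] := pselect (zeros S a); [by left|].
move=> /existsNP [p] /not_implyP [Sp /eqP p0]; right=> q Tq.
have /eqP : peval (p * q) a = 0 by apply: h; exists p, q.
by rewrite -evalatE rmorphM /= !evalatE mulf_eq0 (negPf p0) => /eqP.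
Qed.

Lemma algebraic0 : algebraic (@set0 'rV[R]_n).
Proof.
exists [set 1]; rewrite eqEsubset; split=> // a /(_ 1 erefl) /eqP.
by rewrite -evalatE rmorph1 oner_eq0.
Qed.

Lemma algebraic_hypersurface p : algebraic [set a | peval p a = 0].
Proof.
by exists [set p]; rewrite eqEsubset; split=> a; [move=> h _ ->|exact].
Qed.

Lemma algebraic_finite_union k (N : nat -> set 'rV[R]_n) :
  (forall i, (i < k)%N -> algebraic (N i)) ->
  algebraic [set a | exists2 i, (i < k)%N & N i a].
Proof.
elim: k => [_|k IHk hN].
  rewrite (_ : mkset _ = set0); first exact: algebraic0.
  by rewrite eqEsubset; split=> // a [].
rewrite (_ : mkset _ = [set a | exists2 i, (i < k)%N & N i a] `|` N k).
  by apply: algebraicU; [apply: IHk => i /ltnW; exact: hN|exact: hN].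
rewrite eqEsubset; split=> a.
  by move=> [i + Na]; rewrite ltnS leq_eqVlt => /predU1P [<-|ik]; [right|left; exists i].
by move=> [[i /ltnW ik Na]|Na]; [exists i|exists k].
Qed.

Lemma zopen_in_nonzero X p : zopen_in X (X `&` [set a | peval p a != 0]).
Proof.
exists [set a | peval p a != 0] => //; rewrite /zopen.
rewrite (_ : ~` _ = [set a | peval p a = 0]); first exact: algebraic_hypersurface.
by rewrite eqEsubset; split=> a /=; [move=> /negP; rewrite negbK => /eqP|move=> ->; rewrite eqxx].
Qed.

Lemma zirreducible_prime Z : zirreducible Z -> is_prime (vanishing_ideal Z : set P).
Proof.
move=> [_ irr]; split; first exact: vanishing_ideal_ideal.
move=> p q Zpq; have := irr _ _ (algebraic_hypersurface p) (algebraic_hypersurface q).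
apply=> a Za; have /eqP := Zpq a Za; rewrite -evalatE rmorphM mulf_eq0.
by case/orP => /eqP; [left|right].
Qed.

Lemma zirreducible_cover Z k (N : nat -> set 'rV[R]_n) : zirreducible Z ->
  (forall i, (i < k)%N -> algebraic (N i)) ->
  Z `<=` [set a | exists2 i, (i < k)%N & N i a] ->
  exists2 i, (i < k)%N & Z `<=` N i.
Proof.
move=> [[a Za] irr]; elim: k => [_ /(_ a Za) []//|k IHk hN ZN].
have := irr [set a | exists2 i, (i < k)%N & N i a] (N k).
case=> [|||/IHk|ZNk].
- by apply: algebraic_finite_union => i /ltnW; exact: hN.
- exact: hN.
- move=> b /ZN [i + Nb]; rewrite ltnS leq_eqVlt.
  by move=> /predU1P [<-|ik]; [right|left; exists i].
- by case=> [i /ltnW /hN //|i /ltnW ik]; exists i.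
- by exists k.
Qed.

Definition decomposition Z k (C : nat -> set 'rV[R]_n) :=
  (forall i, (i < k)%N -> algebraic (C i) /\ zirreducible (C i)) /\
  Z = [set a | exists2 i, (i < k)%N & C i a].

Lemma irreducible_decomposition Z : algebraic Z -> exists k C, decomposition Z k C.
Proof.
move=> aZ; apply: contrapT => nZ.
pose F := [set J : set P | exists Y, [/\ algebraic Y,
  ~ (exists k C, decomposition Y k C) & J = vanishing_ideal Y]].
have [|| _ [Y [aY nY ->]] Ymax] := @noetherian_max P F (@noetherian_mpoly R n).
- by move=> _ [Y [_ _ ->]]; exact: vanishing_ideal_ideal.
- by exists (vanishing_ideal Z), Z.
have sub W : algebraic W -> ~ (Y `<=` W) -> exists k C, decomposition (Y `&` W) k C.
  move=> aW YW; apply: contrapT => nYW; apply: YW.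
  have /Ymax : F (vanishing_ideal (Y `&` W)).
    by exists (Y `&` W); split=> //; exact: algebraicI.
  move=> /(_ (vanishing_ideal_sub (@subIsetl _ _ _))) h a Ya.
  suff : (Y `&` W) a by case.
  rewrite -(zeros_vanishing_ideal (algebraicI aY aW)) => p /h; exact.
have [Y0|Y0] := pselect (Y !=set0); last first.
  apply: nY; exists 0%N, (fun=> set0); split=> //; rewrite eqEsubset; split=> a.
    by move=> Ya; case: Y0; exists a.
  by case.
apply: nY; have [irr|] := pselect (zirreducible Y).
  exists 1%N, (fun=> Y); split=> //; rewrite eqEsubset; split=> a; first by exists 0%N.
  by case.
move=> /not_andP [//|].
move=> /existsNP [V] /existsNP [W] /not_implyP [aV] /not_implyP [aW].
move=> /not_implyP [YVW] /not_orP [nV nW].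
have [k [C [hC YV]]] := sub _ aV nV; have [l [D [hD YW]]] := sub _ aW nW.
exists (k + l)%N, (fun i => if (i < k)%N then C i else D (i - k)%N); split.
  move=> i ltikl; case: ifPn => [/hC //|]; rewrite -leqNgt => leki.
  by apply: hD; rewrite ltn_subLR.
rewrite eqEsubset; split=> a.
  move=> Ya; case: (YVW a Ya) => [Va|Wa].
    have : (Y `&` V) a by []; rewrite YV => -[i ik Ca]; exists i; rewrite ?ik //.
    by rewrite ltn_addr.
  have : (Y `&` W) a by []; rewrite YW => -[i ik Ca]; exists (k + i)%N.
    by rewrite ltn_add2l.
  by rewrite ltnNge leq_addr /= addKn.
move=> [i ltikl]; case: ifPn => [ik Ca|].
  suff : (Y `&` V) a by case.
  by rewrite YV; exists i.
rewrite -leqNgt => leki Da; suff : (Y `&` W) a by case.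
by rewrite YW; exists (i - k)%N => //; rewrite ltn_subLR.
Qed.

(** [N] gathers the components that miss [x]. An irreducible subset not inside [N] lies in a
    component through [x], so chains in a small neighbourhood can be compared with the local ring at
    [x]. *)
Lemma components_at x Z : algebraic Z -> exists N k C,
  [/\ algebraic N, ~ N x,
      forall i, (i < k)%N -> [/\ algebraic (C i), zirreducible (C i), C i `<=` Z & C i x] &
      forall T, zirreducible T -> T `<=` Z -> ~ (T `<=` N) ->
        exists2 i, (i < k)%N & T `<=` C i].
Proof.
move=> /irreducible_decomposition [k [C [hC ZC]]].
pose t := [seq i <- iota 0 k | `[< C i x >]].
(* The difference is [C i] if [C i] misses [x], and empty otherwise. *)
exists [set a | exists2 i, (i < k)%N & (C i `\` [set _ | C i x]) a].
exists (size t), (fun j => C (nth 0%N t j)); split.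
- apply: algebraic_finite_union => i ik; have [Cx|Cx] := pselect (C i x).
    rewrite (_ : _ `\` _ = set0); first exact: algebraic0.
    by rewrite eqEsubset; split=> // a [].
  rewrite (_ : _ `\` _ = C i); first by have [] := hC i ik.
  by rewrite eqEsubset; split=> // a [].
- by move=> [i _ []].
- move=> j jt; have := mem_nth 0%N jt.
  rewrite mem_filter mem_iota add0n => /andP [/asboolP Cx /= ltk].
  have [aC iC] := hC _ ltk; split=> //.
  by rewrite ZC => a Ca; exists (nth 0%N t j).
- move=> T irrT TZ nTN; have [||i ik TC] := zirreducible_cover (N := C) (k := k) irrT.
  + by move=> i /hC [].
  + by rewrite -ZC.
  have Cx : C i x.
    apply: contrapT => nCx; apply: nTN => a /TC Ca; exists i => //; by split.
  have it : i \in t by rewrite mem_filter mem_iota add0n /= ik andbT; apply/asboolP.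
  by exists (index i t); rewrite ?index_mem ?nth_index.
Qed.

(** A maximal family [F] in the ideal of [X] with independent gradients at [x] is completed by
    linear forms [us]; the rank-nullity formula identifies their number with the tangent
    dimension. *)
Lemma tangent_params X x d : X x -> has_tangent_dim X x d ->
  exists F us, [/\ forall p, p \in F -> vanishing_ideal X p,
    params x (F ++ us) & size us = d].
Proof.
move=> Xx [T TP dimT].
pose fam k F := [/\ size F = k, forall p, p \in F -> vanishing_ideal X p &
  free [seq grad p x | p <- F]].
have ex : exists k, `[< exists F, fam k F >].
  exists 0%N; apply/asboolP; exists [::]; split=> //; exact: nil_free.
have bound k : `[< exists F, fam k F >] -> (k <= n)%N.
  move=> /asboolP [F [<- _]]; rewrite /free size_map => /eqP <-.
  by rewrite (leq_trans (dimvS (subvf _))) // dimvf /dim /= mul1n.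
case: (ex_maxnP ex bound) => k /asboolP [F [szF FX frF]] kmax.
set U := <<[seq grad p x | p <- F]>>%VS.
have Ugrad p : vanishing_ideal X p -> grad p x \in U.
  move=> Xp; apply: contraT => nU; suff : (k < k)%N by rewrite ltnn.
  apply: kmax; apply/asboolP; exists (p :: F); split.
  - by rewrite /= szF.
  - by move=> q; rewrite inE => /predU1P [->|/FX].
  - by rewrite /= free_cons nU.
pose lin (w : 'rV[R]_n) : P := \sum_j w ord0 j *: coordat x j.
have grad_lin w : grad (lin w) x = w.
  apply/rowP => j; rewrite mxE /lin raddf_sum /= -evalatE rmorph_sum /=.
  rewrite (bigD1 j) //= big1 ?addr0.
    rewrite mpoly.mderivZ mderiv_coordat eqxx /= evalatE /peval mpoly.mevalZ.
    by rewrite mpoly.mevalC mulr1.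
  move=> i ij; rewrite mpoly.mderivZ mderiv_coordat (negPf ij) evalatE /peval mpoly.mevalZ.
  by rewrite mpoly.mevalC mulr0.
pose us := [seq lin w | w <- vbasis U^C].
have gradE : [seq grad p x | p <- F ++ us] = [seq grad p x | p <- F] ++ vbasis U^C.
  rewrite map_cat -map_comp; congr (_ ++ _).
  by rewrite -[RHS]map_id; apply: eq_map => w /=; exact: grad_lin.
have dimU : \dim U = k by rewrite (eqP frF) size_map.
have szus : (k + size us)%N = n.
  rewrite size_map size_tuple dimv_compl dimU dimvf /dim /= mul1n subnKC //.
  by apply: bound; apply/asboolP; exists F.
have sz : size (F ++ us) = n by rewrite size_cat szF.
have par : params x (F ++ us).
  split=> //.
    move=> p; rewrite mem_cat => /orP [/FX|/mapP [w _ ->]]; first exact.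
    rewrite -evalatE rmorph_sum big1 // => j _ /=.
    by rewrite evalatE /peval mpoly.mevalZ -/(peval _ x) peval_coordat subrr mulr0.
  rewrite jacobian_free // gradE cat_free frF (basis_free (vbasisP _)) /=.
  by rewrite directvE /= (span_basis (vbasisP _)) -/U addv_complf dimv_compl subnKC ?dimvS ?subvf.
exists F, us; split=> //.
set M := map_mx (evalat x) (jacobian (F ++ us)).
have Mu : M \in unitmx.
  by rewrite unitmxE det_map_mx unitfE; have [] := par.
have MF (i : 'I_k) (j : 'I_n) (ltin : (i < n)%N) : M (Ordinal ltin) j = grad F`_i x ord0 j.
  by rewrite !mxE nth_cat szF /= (ltn_ord i).
have lekn : (k <= n)%N by rewrite -szus leq_addr.
pose B : 'M[R]_(n, k) := \matrix_(j, i) grad F`_i x ord0 j.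
pose f : 'Hom('rV[R]_n, 'rV[R]_k) := linfun (mulmxr B).
(* The differentials of [F] suffice, since by maximality they span those of the whole ideal. *)
have TE : T = lker f.
  apply/vspaceP => v; rewrite memv_ker lfunE /=; apply/idP/eqP.
    move=> /TP Tv; apply/rowP => i; rewrite !mxE -[RHS](Tv F`_i).
      by apply: eq_bigr => j _; rewrite mulrC !mxE.
    by apply: FX; rewrite mem_nth ?szF.
  move=> vB; apply/TP => p /Ugrad; rewrite /U.
  move=> /(@coord_span _ _ _ (in_tuple [seq grad p0 x | p0 <- F])) gE.
  have -> : \sum_(i < n) peval (mpoly.mderiv i p) x * v ord0 i = (v *m (grad p x)^T) ord0 ord0.
    by rewrite mxE; apply: eq_bigr => j _; rewrite !mxE mulrC.
  rewrite gE linear_sum /= mulmx_sumr summxE big1 // => i _.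
  have lti : (i < k)%N by rewrite -szF -(size_map (fun p0 => grad p0 x)).
  have /rowP /(_ (Ordinal lti)) vBi := vB.
  rewrite linearZ /= -scalemxAr (_ : v *m _ = 0) ?scaler0 ?mxE //.
  apply/matrixP => l l'; rewrite !ord1 mxE [RHS]mxE.
  move: vBi; rewrite mxE [RHS]mxE => vBi; rewrite -[RHS]vBi; apply: eq_bigr => j _.
  by rewrite !mxE (nth_map 0) ?szF // mxE.
have full : limg f = fullv.
  apply/vspaceP => w; rewrite memvf; apply/memv_imgP.
  pose c : 'cV[R]_n := \col_i (if insub (i : nat) is Some i' then w ord0 (i' : 'I_k) else 0).
  exists (invmx M *m c)^T; rewrite ?memvf // lfunE /=; apply/rowP => i.
  have lti : (i < n)%N by exact: leq_trans lekn.
  have : (M *m (invmx M *m c)) (Ordinal lti) ord0 = w ord0 i.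
    by rewrite mulKVmx // mxE /= valK.
  rewrite mxE => <-; rewrite mxE; apply: eq_bigr => j _.
  by rewrite MF mulrC; congr (_ * _); rewrite !mxE.
have := limg_ker_dim f fullv.
rewrite capfv -TE dimT full !dimvf /dim /= !mul1n => dk.
by apply/eqP; rewrite -(eqn_add2l k) szus addnC dk.
Qed.

End Varieties.

(** * Local equations at nonsingular points *)

Section LocalEquations.
Variables (R : realType) (n : nat).
Local Notation P := (mpoly.mpoly n R).
Implicit Types (a b x : 'rV[R]_n) (p q : P) (X Y Z U : set 'rV[R]_n).

Lemma span_vanishing (F : seq P) a p : (forall q, q \in F -> peval q a = 0) ->
  span F p -> peval p a = 0.
Proof.
move=> Fa; have sF : span F `<=` vanishing_ideal [set a].
  by apply: span_sub; [exact: vanishing_ideal_ideal|move=> q /Fa qa _ ->].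
by move=> /sF; apply.
Qed.

Lemma prime_loc Z J a p : is_prime (vanishing_ideal Z : set P) -> Z a ->
  J `<=` vanishing_ideal Z -> loc (evalat a) J p -> vanishing_ideal Z p.
Proof.
by move=> [_ pZ] Za JZ; apply: (loc_prime pZ) => // q; apply.
Qed.

Lemma neq_coordat a b : a != b -> exists j, peval (coordat a j) b != 0.
Proof.
move=> ab; apply: contrapT => nj; case/eqP: ab; apply/rowP => j.
apply/eqP; rewrite eq_sym -subr_eq0 -peval_coordat; apply: contrapT => /negP h.
by apply: nj; exists j.
Qed.

Lemma coordat_point Z a : (forall j, vanishing_ideal Z (coordat a j)) -> Z `<=` [set a].
Proof.
move=> Zj b Zb; apply: esym; apply/eqP; apply: contrapT => /negP /neq_coordat [j].
by rewrite Zj ?eqxx.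
Qed.

(** Converse of [params_max]: differentiating the expressions of the coordinates in terms of [s]
    factors an invertible diagonal matrix through the Jacobian matrix. *)
Lemma generators_params a (s : seq P) : size s = n ->
  (forall p, p \in s -> peval p a = 0) ->
  (forall p, peval p a = 0 -> loc (evalat a) (span s) p) -> params a s.
Proof.
move=> szs s0 hm; split; [by []|by []|].
have /choice [f fP] : forall j : 'I_n, exists sc : P * ('I_n -> P),
    peval sc.1 a != 0 /\ sc.1 * coordat a j = \sum_i sc.2 i * s`_i.
  move=> j; have [|r r0 /spanP [c cE]] := hm (coordat a j).
    by rewrite peval_coordat subrr.
  exists (r, fun i => c (cast_ord (esym szs) i)); split=> //=.
  have bij : {on predT, bijective (cast_ord (esym szs))}.
    by exists (cast_ord szs) => i _; rewrite ?cast_ordK ?cast_ordKV.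
  by rewrite cE (reindex _ bij).
pose C : 'M[R]_n := \matrix_(j, i) peval ((f j).2 i) a.
have : C *m map_mx (evalat a) (jacobian s) = diag_mx (\row_j peval (f j).1 a).
  apply/matrixP => j k; have [_] := fP j.
  move/(congr1 (fun p => peval (mpoly.mderiv k p) a)).
  rewrite mpoly.mderivM -evalatE rmorphD !rmorphM /= !evalatE peval_coordat subrr mulr0 add0r.
  rewrite mderiv_coordat {2}/peval mpoly.mevalC !mxE mulr_natr => ->.
  rewrite raddf_sum -evalatE rmorph_sum; apply: eq_bigr => i _ /=.
  rewrite mpoly.mderivM rmorphD !rmorphM /= !evalatE !mxE (s0 s`_i) ?mulr0 ?add0r //.
  by rewrite mem_nth ?szs.
move/(congr1 determinant); rewrite det_mulmx det_diag => dE.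
have : \prod_(i < n) (\row_j peval (f j).1 a) ord0 i != 0.
  by apply/prodf_neq0 => j _; rewrite mxE; have [] := fP j.
by rewrite -dE det_map_mx mulf_eq0 negb_or => /andP [].
Qed.

(** On a smooth curve germ [J = 0], the equation [s] is a unit times a power of [v], so [v] vanishes
    on [Z], and with it every coordinate centred at [b]. *)
Lemma dvr_prime_point Z b (J : set P) v s : is_ideal J ->
  is_prime (vanishing_ideal Z : set P) -> Z b -> J `<=` vanishing_ideal Z ->
  (forall p, peval p b = 0 -> loc (evalat b) (adjoin J v) p) -> peval v b = 0 ->
  vanishing_ideal Z s -> ~ loc (evalat b) J s -> Z `<=` [set b].
Proof.
move=> hJ pZ Zb JZ hm v0 Zs nJs.
have [e [r [w [_ w0 Jr]]]] := dvr_order (@noetherian_mpoly R n) hJ v0 hm nJs.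
have [hZ pZ'] := pZ.
have Zv : vanishing_ideal Z v.
  apply: (prime_exp (k := e) pZ).
    by move=> /(_ b Zb) /eqP; rewrite -evalatE rmorph1 oner_eq0.
  have /pZ' [/(_ b Zb) /eqP|//] : vanishing_ideal Z (w * v ^+ e).
    by apply: (ideal_subr hZ (JZ _ Jr)); exact: (idealMl _ hZ Zs).
  by rewrite (negPf w0).
apply: coordat_point => j; apply: (@prime_loc Z (adjoin J v) b) => //.
  exact: adjoin_sub.
by apply: hm; rewrite peval_coordat subrr.
Qed.

Lemma zclosed_in_separate U Y Z : zclosed_in U Z -> zclosed_in U Y -> Z `<` Y ->
  exists2 s, vanishing_ideal Z s & ~ vanishing_ideal Y s.
Proof.
move=> [F aF ->] [G aG ->] [_ nYZ]; apply: contrapT => ns; apply: nYZ => a Ya.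
have [Ua _] := Ya; split=> //; rewrite -(zeros_vanishing_ideal aF) => p Fp.
apply: contrapT => pa; apply: ns; exists p; first by move=> b [_ Fb]; exact: Fp.
by move=> /(_ a Ya).
Qed.

Lemma zclosed_in_sub U Z : zclosed_in U Z -> Z `<=` U.
Proof. by move=> [F _ ->] a []. Qed.

Lemma zopen_inC X Y : algebraic Y -> zopen_in X (X `&` ~` Y).
Proof. by move=> aY; exists (~` Y); rewrite /zopen ?setCK. Qed.

Lemma properset_neq Y Z a : Z !=set0 -> Z `<` Y -> exists2 b, Y b & b != a.
Proof.
move=> [c Zc] [ZY nYZ]; apply: contrapT => nb; apply: nYZ => d Yd.
have eqa b : Y b -> b = a.
  by move=> Yb; apply/eqP; apply: contrapT => /negP ba; apply: nb; exists b.
by rewrite (eqa d Yd) -(eqa c (ZY _ Zc)).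
Qed.

Lemma local_equations0 X x F : X x -> params x F ->
  vanishing_ideal X `<=` loc (evalat x) (span F).
Proof. by move=> Xx par p /(_ x Xx); exact: params_max. Qed.

(** A further equation [q] would be a unit times [v^e] modulo [F]; then [v] would vanish on [X] near
    [x], and [x] would be Zariski isolated, leaving no room for a chain of length 1. *)
Lemma local_equations1 X x F v : X x ->
  (forall p, p \in F -> vanishing_ideal X p) -> params x (v :: F) ->
  (forall U, zopen_in X U -> U x -> has_zchain U 1) ->
  vanishing_ideal X `<=` loc (evalat x) (span F).
Proof.
move=> Xx FX par chain q Xq; apply: contrapT => nq.
have hF := span_ideal F; have hX := vanishing_ideal_ideal X.
have sFX : span F `<=` vanishing_ideal X by exact: span_sub.
have v0 : peval v x = 0 by have [_ + _] := par; apply; rewrite mem_head.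
have hm p : peval p x = 0 -> loc (evalat x) (adjoin (span F) v) p.
  exact: params_max par.
have [e [s [w [_ w0 Fq]]]] := dvr_order (@noetherian_mpoly R n) hF v0 hm nq.
have Xwv : vanishing_ideal X (w * v ^+ e).
  by apply: (ideal_subr hX (sFX _ Fq)); exact: (idealMl _ hX Xq).
have [|r r0 rJ] := @loc_uniform _ _ (evalat x) (adjoin (span F) v)
    (vanishing_ideal [set x]) (@noetherian_mpoly R n) (adjoin_ideal v hF)
    (vanishing_ideal_ideal _).
  by move=> p /(_ x erefl); exact: hm.
pose U := X `&` [set a | peval (w * r) a != 0].
have Ux : U `<=` [set x].
  move=> a [Xa]; rewrite /= -evalatE rmorphM mulf_eq0 negb_or => /andP [wa ra].
  have va : peval v a = 0.
    have /eqP := Xwv a Xa; rewrite -evalatE rmorphM mulf_eq0 (negPf wa) /=.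
    by rewrite rmorphXn expf_eq0 => /andP [_ /eqP].
  apply: (@coordat_point [set a]) => // j _ ->.
  have [|c Fc] := rJ (coordat x j); first by move=> _ ->; rewrite peval_coordat subrr.
  have /eqP := sFX _ Fc a Xa; rewrite -evalatE rmorphB !rmorphM /= !evalatE va mulr0 subr0.
  by rewrite mulf_eq0 (negPf ra) => /eqP.
have [||Z [ZP /(_ 0%N isT) Z01]] := chain U; first exact: zopen_in_nonzero.
  by split=> //=; rewrite -evalatE rmorphM mulf_neq0.
have [_ [Z0 _]] := ZP 0%N isT; have [/zclosed_in_sub Z1 _] := ZP 1%N isT.
have [b /Z1 /Ux -> ] := properset_neq x Z0 Z01.
by rewrite eqxx.
Qed.

(** Replacing [u] by [h = u - c v], with [c] from [regular_order], keeps the ideal of the parameters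
    and makes [q] a unit times a power of [v] on the curve [F = h = 0]. *)
Lemma surface_expansion x F u v q : params x [:: v, u & F] ->
  ~ loc (evalat x) (span F) q ->
  exists h s w e, [/\ params x [:: v, h & F], peval s x != 0, peval w x != 0 &
    span (h :: F) (s * q - w * v ^+ e)].
Proof.
move=> par nq; have [sz par0 _] := par.
have v0 : peval v x = 0 by apply: par0; rewrite mem_head.
have u0 : peval u x = 0 by apply: par0; rewrite !inE eqxx orbT.
have hm p : peval p x = 0 -> loc (evalat x) (adjoin (adjoin (span F) u) v) p.
  exact: params_max par.
have [c [e [s [w [s0 w0 Fq]]]]] :=
  regular_order (@noetherian_mpoly R n) (span_ideal F) u0 v0 hm nq.
exists (u - c%:R * v), s, w, e; split; [|exact: s0|exact: w0|exact: Fq].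
apply: generators_params; [exact: sz| |].
  move=> p; rewrite !inE => /or3P [/eqP -> //|/eqP ->|pF].
    by rewrite -evalatE rmorphB rmorphM /= !evalatE u0 v0 mulr0 subr0.
  by apply: par0; rewrite !inE pF !orbT.
move=> p /hm; apply: loc_mono => r [a [b Fr]]; exists (a + b * c%:R); exists b.
by move: Fr; congr (span F _); ring.
Qed.

(** The derivation along [F = h = 0] does not kill [v] at [x], because [v], [h] and [F] are
    parameters there. *)
Lemma unstable_direction Y x F h v s w e q : params x [:: v, h & F] -> Y x ->
  peval w x != 0 -> span (h :: F) (s * q - w * v ^+ e) -> vanishing_ideal Y q ->
  exists2 g, vanishing_ideal Y g &
    ~ vanishing_ideal Y (jacobian_derivation (h :: F) g).
Proof.
move=> par Yx w0 Fq Yq; have [sz par0 _] := par.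
have szt : (size (h :: F)).+1 = n by exact: sz.
apply: (@derivation_unstable _ _ (evalat x) _ (span (h :: F)) _ v e s w q) => //.
- exact: jacobian_derivationP.
- exact: vanishing_ideal_ideal.
- by move=> p; exact: jacobian_derivation_span.
- move=> p; apply: span_vanishing => r rF.
  by apply: par0; rewrite inE rF orbT.
- by move=> p; apply.
- by apply: par0; rewrite mem_head.
- suff [] : params x (rcons (h :: F) v) by [].
  by apply: params_perm par; rewrite perm_sym perm_rcons.
Qed.

(** An equation [q] outside the local ideal of [F] leaves no room for [Z 0 < Z 1 < Z 2] in a
    component [C i] through [x]: the chain is refuted at a point of [Z 1] where [E (g i)] is
    nonzero, or else by the principal ideal theorem at [x]. *)
Lemma local_equations2 X x F u v : algebraic X -> X x ->
  (forall p, p \in F -> vanishing_ideal X p) -> params x [:: v, u & F] ->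
  (forall U, zopen_in X U -> U x -> has_zchain U 2) ->
  vanishing_ideal X `<=` loc (evalat x) (span F).
Proof.
move=> aX Xx FX par chain q Xq; apply: contrapT => nq.
have nP := @noetherian_mpoly R n.
have hF := span_ideal F; have hX := vanishing_ideal_ideal X.
have sFX : span F `<=` vanishing_ideal X by exact: span_sub.
have [h [s [w [e [par' s0 w0 Fq]]]]] := surface_expansion par nq.
have [sz par0 _] := par'.
have v0 : peval v x = 0 by apply: par0; rewrite mem_head.
have h0 : peval h x = 0 by apply: par0; rewrite !inE eqxx orbT.
have hm p : peval p x = 0 -> loc (evalat x) (adjoin (adjoin (span F) h) v) p.
  exact: params_max par'.
pose E := jacobian_derivation (h :: F).
have [N0 [k [C [aN0 N0x CP CT]]]] := components_at x aX.
have /choice [g gP] : forall i, exists g, (i < k)%N ->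
    vanishing_ideal (C i) g /\ ~ vanishing_ideal (C i) (E g).
  move=> i; have [ik|_] := boolP (i < k)%N; last by exists 0.
  by have [_ _ CX Cx] := CP i ik; have [g Cg nCg] :=
    unstable_direction par' Cx w0 Fq (vanishing_ideal_sub CX Xq); exists g.
pose T i := C i `&` [set a | peval (E (g i)) a = 0].
have /choice [N NP] : forall i, exists N, [/\ algebraic N, ~ N x & (i < k)%N ->
    forall Z, zirreducible Z -> Z `<=` T i -> ~ (Z `<=` N) ->
    exists D, [/\ zirreducible D, D `<=` T i, D x & Z `<=` D]].
  move=> i; have [ik|_] := boolP (i < k)%N; last first.
    by exists set0; split=> //; exact: algebraic0.
  have [aC _ _ _] := CP i ik.
  have [|N [l [D [aN Nx DP DT]]]] := @components_at R n x (T i).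
    by apply: algebraicI => //; exact: algebraic_hypersurface.
  exists N; split=> // _ Z irrZ ZT ZN; have [j jl ZD] := DT Z irrZ ZT ZN.
  by exists (D j); have [] := DP j jl.
(* Off [M], [Z 2] lies in a component of [X] through [x], and [Z 1], if [E (g i)] vanishes on it, in
   a component of [T i] through [x]. *)
pose M := N0 `|` [set a | exists2 i, (i < k)%N & N i a].
have aM : algebraic M.
  apply: algebraicU => //; apply: algebraic_finite_union => i _.
  by have [] := NP i.
have [||Z [ZP Zlt]] := chain (X `&` ~` M); first exact: zopen_inC.
  by split=> // -[//|[i _]]; have [] := NP i.
have [cZ0 [Z0 _]] := ZP 0%N isT.
have [cZ1 iZ1] := ZP 1%N isT; have [cZ2 iZ2] := ZP 2%N isT.
have Z01 := Zlt 0%N isT; have Z12 := Zlt 1%N isT.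
have [Z10 _] := iZ1; have [Z20 _] := iZ2.
have ZM Y W : Y !=set0 -> zclosed_in (X `&` ~` M) Y -> W `<=` M -> ~ (Y `<=` W).
  by move=> [a Ya] /zclosed_in_sub /(_ a Ya) [_ Ma] WM /(_ a Ya) /WM.
have [i ik Z2C] : exists2 i, (i < k)%N & Z 2%N `<=` C i.
  apply: CT => //; first by move=> a /(zclosed_in_sub cZ2) [].
  by apply: ZM cZ2 _ => // a; left.
have [aC iC CX Cx] := CP i ik; have [Cg nCEg] := gP i ik.
have pC := zirreducible_prime iC.
have [s1 Z1s nZ2s] := zclosed_in_separate cZ1 cZ2 Z12.
have nCs : ~ vanishing_ideal (C i) s1 by move=> /(vanishing_ideal_sub Z2C).
have Z1C : Z 1%N `<=` C i by apply: subset_trans Z2C; case: Z12.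
(* At a point [b] of [Z 1] where [E (g i)] is nonzero, [g i] and [F] define a smooth curve germ
   containing [C i]. As [s1] vanishes on [Z 1] but not on [C i], [Z 1] is the point [b], which
   cannot properly contain [Z 0]. *)
have [Z1E|] := pselect (Z 1%N `<=` [set a | peval (E (g i)) a = 0]); last first.
  move=> /existsNP [b /not_implyP [Z1b /eqP Eb]].
  pose v' := h - mpoly.mpolyC n (peval h b).
  have gFC p : p \in g i :: F -> vanishing_ideal (C i) p.
    by rewrite inE => /predU1P [->//|/FX]; exact: vanishing_ideal_sub.
  have parb : params b [:: v', g i & F].
    apply: jacobian_derivation_params => // p /gFC; apply; exact: Z1C.
  have v'0 : peval v' b = 0 by have [_ + _] := parb; apply; rewrite mem_head.
  have sgC : span (g i :: F) `<=` vanishing_ideal (C i).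
    by apply: span_sub => //; exact: vanishing_ideal_ideal.
  have Z1b' : Z 1%N `<=` [set b].
    apply: (@dvr_prime_point _ b (span (g i :: F)) v' s1) => //.
    - exact: span_ideal.
    - exact: zirreducible_prime.
    - exact: subset_trans (vanishing_ideal_sub Z1C).
    - by move=> p; exact: params_max parb.
    - by move=> /(prime_loc pC (Z1C _ Z1b) sgC).
  by have [d /Z1b' ->] := properset_neq b Z0 Z01; rewrite eqxx.
(* Otherwise the ideals of [C i], [D] and [x] form a strict chain of primes: [E (g i)] separates
   [C i] from [D], and [D] contains a point of [Z 1] other than [x]. *)
have [_ _ NT] := NP i.
have [||D [iD DT Dx Z1D]] := NT ik (Z 1%N) iZ1.
- by move=> a Za; split; [exact: Z1C|exact: Z1E].
- by apply: ZM cZ1 _ => // a Na; right; exists i.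
have [b Z1b bx] := properset_neq x Z0 Z01.
have [|j zj] := @neq_coordat x b; first by rewrite eq_sym.
apply: nCEg; apply: (@height_le2 _ _ (evalat x) (span F) _ (vanishing_ideal D)
  h v e s w q (coordat x j)) => //.
- exact: zirreducible_prime.
- exact: subset_trans sFX (vanishing_ideal_sub CX).
- by apply: vanishing_ideal_sub => a /DT [].
- by move=> p; apply.
- by rewrite evalatE peval_coordat subrr.
- by move=> /(_ b (Z1D _ Z1b)) /eqP; rewrite (negPf zj).
- exact: vanishing_ideal_sub Xq.
- by move=> a /DT [].
Qed.

(* [us ++ F] are local coordinates of the affine space at [x]: the equations [F]
   define [X] near [x], and [us] restricts to local coordinates of [X]. *)
Definition regular_point X x F us :=
  [/\ forall p, p \in F -> vanishing_ideal X p, params x (us ++ F),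
      (size us <= 2)%N & vanishing_ideal X `<=` loc (evalat x) (span F)].

Lemma has_zchain_le U d d' : (d' <= d)%N -> has_zchain U d -> has_zchain U d'.
Proof.
move=> le [Z [ZP Zlt]]; exists Z; split=> i lti.
  by apply: ZP; exact: leq_trans le.
by apply: Zlt; exact: leq_trans le.
Qed.

(** The local dimension is at most 2 because [X] is a neighbourhood of [x] in itself; smaller
    components of [X] account for the cases 0 and 1. *)
Theorem surface_regular_point X x : algebraic_surface X -> nonsingular X -> X x ->
  exists F us, regular_point X x F us.
Proof.
move=> [aX [_ nchain]] ns Xx; have [d [_ chain] /(tangent_params Xx)] := ns x Xx.
move=> [F [us [FX par szus]]].
have d2 : (d <= 2)%N.
  rewrite leqNgt; apply/negP => d3; apply: nchain; apply: (has_zchain_le d3).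
  apply: chain => //; exists setT; last by rewrite setIT.
  by rewrite /zopen setCT; exact: algebraic0.
have par' : params x (us ++ F) by apply: params_perm par; rewrite perm_catC.
exists F, us; split; rewrite ?szus //.
move: szus d2 par' chain; case: us {par} => [<- _|v [<- _|u [<- _|w us <- //]]] par chain.
- exact: local_equations0.
- exact: (local_equations1 Xx FX par chain).
- exact: (local_equations2 aX Xx FX par chain).
Qed.

End LocalEquations.

(** * Points near a nonsingular point *)

(** Completeness of the space of row vectors serves the Banach fixed point theorem in
    [curve_points]. *)
HB.instance Definition _ (R : realType) (m n : nat) :=
  Uniform_isComplete.Build 'M[R]_(m, n) cauchy_cvg.

Section Density.
Variables (R : realType) (n : nat).
Local Notation P := (mpoly.mpoly n R).
Implicit Types (x y : 'rV[R]_n) (p q : P) (X U : set 'rV[R]_n).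

Lemma coord_le_norm (v : 'rV[R]_n) j : `|v ord0 j| <= `|v|.
Proof.
rewrite /Num.norm /= mx_normrE.
exact: (le_bigmax _ (fun ij : 'I_1 * 'I_n => `|v ij.1 ij.2|) (ord0, j)).
Qed.

Lemma norm_le_coord (v : 'rV[R]_n) c : 0 <= c -> (forall j, `|v ord0 j| <= c) -> `|v| <= c.
Proof.
move=> c0 vc; rewrite /Num.norm /= mx_normrE; apply: bigmax_le => // -[i j] _ /=.
by rewrite ord1.
Qed.

Lemma peval_lipschitz x p : exists2 L, 0 <= L & forall y z,
  `|y - x| <= 1 -> `|z - x| <= 1 ->
  `|peval p y| <= L /\ `|peval p y - peval p z| <= L * `|y - z|.
Proof.
elim/mpoly_ring_ind: p => [c|i|p q [L L0 hL] [M M0 hM]|p q [L L0 hL] [M M0 hM]].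
- exists `|c| => // y z _ _; rewrite /peval !mpoly.mevalC subrr normr0.
  by split=> //; rewrite mulr_ge0.
- exists (`|x| + 1) => [|y z yx zx]; first by rewrite addr_ge0.
  rewrite /peval !mpoly.mevalXU; split.
    rewrite (le_trans (coord_le_norm _ _)) // -[y](subrK x) addrC.
    by rewrite (le_trans (ler_normD _ _)) // lerD2l.
  have := coord_le_norm (y - z) i; rewrite !mxE => h; apply: (le_trans h).
  by rewrite ler_peMl // lerDr.
- exists (L + M) => [|y z yx zx]; first exact: addr_ge0.
  have [Ly Lyz] := hL y z yx zx; have [My Myz] := hM y z yx zx.
  rewrite -!evalatE !rmorphD /= !evalatE; split.
    by rewrite (le_trans (ler_normD _ _)) // lerD.
  by rewrite opprD addrACA mulrDl (le_trans (ler_normD _ _)) // lerD.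
- exists (L * M + L * M) => [|y z yx zx]; first by rewrite addr_ge0 ?mulr_ge0.
  have [Ly Lyz] := hL y z yx zx; have [My Myz] := hM y z yx zx.
  have [Lz _] := hL z y zx yx.
  rewrite -!evalatE !rmorphM /= !evalatE; split.
    by rewrite normrM (le_trans (ler_pM _ _ Ly My)) // lerDl mulr_ge0.
  have -> : peval p y * peval q y - peval p z * peval q z =
    (peval p y - peval p z) * peval q y + peval p z * (peval q y - peval q z) by ring.
  rewrite (le_trans (ler_normD _ _)) // !normrM mulrDl lerD //.
    by rewrite mulrAC (le_trans (ler_pM _ _ Lyz My)).
  by rewrite -mulrA (le_trans (ler_pM _ _ Lz Myz)).
Qed.

Lemma peval_near0 x p (e : R) : 0 < e -> exists2 d, 0 < d &
  forall y, `|y - x| < d -> `|peval p y - peval p x| < e.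
Proof.
move=> e0; have [L L0 hL] := peval_lipschitz x p.
have L1 : 0 < L + 1 by lra.
exists (Num.min 1 (e / (L + 1))) => [|y]; first by rewrite lt_min ltr01 divr_gt0.
rewrite lt_min => /andP [y1 yd].
have [|_ h] := hL y x (ltW y1); first by rewrite subrr normr0.
apply: (le_lt_trans h); apply: (@le_lt_trans _ _ ((L + 1) * `|y - x|)).
  by rewrite ler_wpM2r // lerDl.
by rewrite mulrC -ltr_pdivlMr.
Qed.

Lemma peval_near_neq0 x p : peval p x != 0 -> exists2 d, 0 < d &
  forall y, `|y - x| < d -> peval p y != 0.
Proof.
move=> px; have [|d d0 hd] := @peval_near0 x p `|peval p x|.
  by rewrite normr_gt0.
exists d => // y /hd; apply: contraTneq => ->.
by rewrite sub0r normrN ltxx.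
Qed.

(** Hadamard's coefficients vanish at a critical point and are Lipschitz, so the slope on a ball of
    radius [d] is [O(d)]; this takes the place of the mean value inequality. *)
Lemma critical_lipschitz x p : grad p x = 0 -> exists2 L, 0 <= L & forall d y z,
  d <= 1 -> `|y - x| <= d -> `|z - x| <= d ->
  `|peval p y - peval p z| <= L * d * `|y - z|.
Proof.
move=> gp; have [c cE] := hadamard x p.
have c0 j : peval (c j) x = 0 by rewrite (hadamard_grad cE) gp mxE.
have /choice [L LP] : forall j, exists L, 0 <= L /\ forall y z,
  `|y - x| <= 1 -> `|z - x| <= 1 -> `|peval (c j) y - peval (c j) z| <= L * `|y - z|.
  move=> j; have [L L0 hL] := peval_lipschitz x (c j); exists L; split=> // y z yx zx.
  by have [] := hL y z yx zx.
have pE y : peval p y = peval p x + \sum_i peval (c i) y * (y ord0 i - x ord0 i).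
  have /(congr1 (fun r => peval r y)) := cE.
  rewrite {1}/peval mpoly.mevalB mpoly.mevalC -/(peval p y) => /eqP.
  rewrite subr_eq => /eqP ->; rewrite addrC; congr (_ + _).
  rewrite -evalatE rmorph_sum; apply: eq_bigr => i _.
  by rewrite rmorphM /= !evalatE peval_coordat.
exists (\sum_i (L i + L i)).
  by apply: sumr_ge0 => i _; have [L0 _] := LP i; rewrite addr_ge0.
move=> d y z d1 yd zd; have d0 : 0 <= d by exact: le_trans yd.
have y1 := le_trans yd d1; have z1 := le_trans zd d1.
rewrite (pE y) (pE z) opprD addrACA subrr add0r -sumrB (le_trans (ler_norm_sum _ _ _)) //.
rewrite -mulrA mulr_suml; apply: ler_sum => i _.
have [L0 hL] := LP i.
have -> : peval (c i) y * (y ord0 i - x ord0 i) - peval (c i) z * (z ord0 i - x ord0 i) =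
  peval (c i) y * (y ord0 i - z ord0 i) +
  (peval (c i) y - peval (c i) z) * (z ord0 i - x ord0 i) by ring.
rewrite (le_trans (ler_normD _ _)) // !normrM mulrDl lerD // mulrA.
  apply: ler_pM => //; last by have := coord_le_norm (y - z) i; rewrite !mxE.
  have := hL y x y1; rewrite subrr normr0 c0 subr0 => /(_ ler01) h.
  by rewrite (le_trans h) // ler_wpM2l.
rewrite mulrAC; apply: ler_pM => //; first exact: hL.
by apply: le_trans zd; have := coord_le_norm (z - x) i; rewrite !mxE.
Qed.

(* The map [y |-> y - (s y - t e_0) J^-1], with [J] the transposed Jacobian
   matrix at [x], is a contraction of a small ball; its fixed point [y] has
   [s y = t e_0]. *)
Lemma curve_points x v (F : seq P) (e : R) : params x (v :: F) -> 0 < e ->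
  exists y, [/\ `|y - x| < e, forall p, p \in F -> peval p y = 0 & peval v y != 0].
Proof.
move=> [sz par0 jac] e0.
have n0 : (0 < n)%N by exact: (leq_ltn_trans (leq0n _) (eq_leq sz)).
pose k0 := Ordinal n0; pose s := v :: F; have szs : size s = n := sz.
pose J : 'M[R]_n := (map_mx (evalat x) (jacobian s))^T.
have Ju : J \in unitmx by rewrite unitmxE det_tr det_map_mx unitfE.
pose B := invmx J.
pose Phi y : 'rV[R]_n := \row_i peval s`_i y.
(* Coordinate [j] of the unshifted map, as a polynomial; the choice of [B] makes its gradient vanish
   at [x]. *)
pose H j : P := mpoly.mpolyX R (mpoly.mnm1 j) - \sum_i B i j *: s`_i.
have HE y j : peval (H j) y = (y - Phi y *m B) ord0 j.
  rewrite -evalatE rmorphB rmorph_sum !mxE /= /peval mpoly.mevalXU.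
  by congr (_ - _); apply: eq_bigr => i _; rewrite mpoly.mevalZ mxE mulrC.
have Phix : Phi x = 0.
  by apply/rowP => i; rewrite !mxE par0 // mem_nth // szs.
have gH j : grad (H j) x = 0.
  apply/rowP => k; rewrite !mxE /H mpoly.mderivB [mpoly.mderiv k (\sum_(_ < n) _)]raddf_sum /=.
  have -> : mpoly.mpolyX R (mpoly.mnm1 j) = coordat x j + mpoly.mpolyC n (x ord0 j).
    by rewrite subrK.
  rewrite mpoly.mderivD mpoly.mderivC addr0 mderiv_coordat -evalatE rmorphB rmorph_sum /=.
  rewrite evalatE {1}/peval mpoly.mevalC.
  have /matrixP /(_ k j) := mulmxV Ju; rewrite !mxE eq_sym => <-.
  apply/eqP; rewrite subr_eq0; apply/eqP; apply: eq_bigr => i _.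
  by rewrite mpoly.mderivZ !mxE evalatE /peval mpoly.mevalZ mulrC.
have /choice [L LP] : forall j, exists L, 0 <= L /\ forall d y z,
    d <= 1 -> `|y - x| <= d -> `|z - x| <= d ->
    `|peval (H j) y - peval (H j) z| <= L * d * `|y - z|.
  by move=> j; have [L L0 hL] := critical_lipschitz (gH j); exists L.
pose M := \sum_j L j.
have LM j : L j <= M.
  rewrite /M (bigD1 j) //= lerDl sumr_ge0 // => i _; by have [] := LP i.
have M0 : 0 <= M by apply: sumr_ge0 => i _; have [] := LP i.
(* The last bound gives [M d <= 1 / 2], hence the contraction ratio [1 / 2]. *)
pose d := Num.min 1 (Num.min (e / 2) (1 / (2 * (M + 1)))).
have d0 : 0 < d by rewrite !lt_min ltr01 !divr_gt0 ?mulr_gt0 //; lra.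
have d1 : d <= 1 by rewrite ge_min lexx.
have de : d < e.
  apply: (@le_lt_trans _ _ (e / 2)); last lra.
  by rewrite !ge_min lexx orbT.
have dM : M * d <= 1 / 2.
  have dle : d <= 1 / (2 * (M + 1)) by rewrite !ge_min lexx !orbT.
  apply: (@le_trans _ _ (M * (1 / (2 * (M + 1))))); first exact: ler_wpM2l.
  rewrite mulrA mulr1 ler_pdivrMr; [lra|by apply: mulr_gt0; lra].
pose E : 'rV[R]_n := \row_i (i == k0)%:R.
(* The shift uses at most half of the radius and the contraction the other half; the [+ 1] keeps the
   denominator positive. *)
pose t := d / (2 * (`|E *m B| + 1)).
have t0 : 0 < t.
  by apply: divr_gt0 => //; apply: mulr_gt0 => //; apply: ltr_wpDl.
have tE : `|t *: (E *m B)| <= d / 2.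
  rewrite normrZ gtr0_norm // /t; set c := `|_|.
  have c0 : 0 <= c by exact: normr_ge0.
  have c1 : 0 < c + 1 by rewrite ltr_wpDl.
  have -> : d / (2 * (c + 1)) * c = d / 2 * (c / (c + 1)) by field; rewrite gt_eqF.
  by rewrite ler_piMr // ?ler_pdivrMr ?mul1r ?lerDl // divr_ge0 // ltW.
pose g y := y - Phi y *m B + t *: (E *m B).
have glip y z : `|y - x| <= d -> `|z - x| <= d -> `|g y - g z| <= 1 / 2 * `|y - z|.
  move=> yd zd; apply: norm_le_coord => [|j]; first by rewrite mulr_ge0 //; lra.
  rewrite /g opprD addrACA subrr addr0; have [_ hL] := LP j.
  have -> : (y - Phi y *m B - (z - Phi z *m B)) ord0 j = peval (H j) y - peval (H j) z.
    have mxB (a b : 'rV[R]_n) : (a - b) ord0 j = a ord0 j - b ord0 j by rewrite !mxE.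
    by rewrite !HE mxB.
  rewrite (le_trans (hL d y z d1 yd zd)) // ler_wpM2r // (le_trans _ dM) //.
  by rewrite ler_wpM2r // ltW.
pose U := closed_ball_ (fun w : 'rV[R]_n => `|w|) x d.
have UE y : U y -> `|y - x| <= d by rewrite /U /closed_ball_ /= distrC.
have gU : {homo g : y / U y >-> U y}.
  move=> y /UE yd; rewrite /U /closed_ball_ /= distrC.
  have -> : g y - x = (g y - g x) + t *: (E *m B).
    by rewrite /g Phix mul0mx subr0 opprD addrA subrK.
  rewrite (le_trans (ler_normD _ _)) // (le_trans (lerD (glip y x yd _) tE)) //.
    by rewrite subrr normr0 ltW.
  lra.
have [||| y /UE yd yE] := @banach_fixed_point R _ U (mkfun gU).
- have h0 : 0 <= 1 / 2 :> R by lra.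
  exists (NngNum h0); split=> [|[y z] [/= /UE yd /UE zd]] /=; first by lra.
  exact: glip.
- exact: closed_closed_ball_.
- by exists x; rewrite /U /closed_ball_ /= subrr normr0 ltW.
have PhiE : Phi y = t *: E.
  have : (Phi y - t *: E) *m B = 0.
    move: yE; rewrite /= /g => /eqP; rewrite eq_sym -subr_eq0 addrC !addrA addNr add0r.
    by rewrite mulmxBl -scalemxAl addrC subr_eq0 => /eqP ->; rewrite subrr.
  move/(congr1 (mulmx^~ J)); rewrite mulmxKV // mul0mx => /eqP.
  by rewrite subr_eq0 => /eqP.
exists y; split; first exact: le_lt_trans de.
- move=> p pF; have lti : ((index p F).+1 < n)%N.
    by rewrite -[ltnRHS]sz /= ltnS index_mem.
  have /rowP /(_ (Ordinal lti)) := PhiE; rewrite !mxE /= nth_index //.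
  by move=> ->; rewrite mulr0.
- have /rowP /(_ k0) := PhiE; rewrite !mxE eqxx mulr1 /= => ->.
  by rewrite gt_eqF.
Qed.

End Density.

(** * Locally bounded rational functions *)

Section Extension.
Variables (R : realType) (n : nat).
Local Notation P := (mpoly.mpoly n R).
Implicit Types (a b x y : 'rV[R]_n) (p q : P) (X Y Z U C D : set 'rV[R]_n).

(** Some equation of [C] is nonzero in the local ring of [X] at [x], so [C] fills no Zariski
    neighbourhood of [x] in [X]. *)
Definition nowhere_dense_at X C x :=
  exists2 q, vanishing_ideal C q & ~ loc (evalat x) (vanishing_ideal X) q.

Lemma zdense_nonvanishing X U p x : zdense_in X U -> X x ->
  (forall y, U y -> peval p y != 0) -> ~ loc (evalat x) (vanishing_ideal X) p.
Proof.
move=> dU Xx Up [s s0 Xsp].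
have [|y [Uy [Xy sy]]] := dU _ (zopen_in_nonzero X s); first by exists x.
have /eqP := Xsp y Xy; rewrite -evalatE rmorphM mulf_eq0.
by rewrite (negPf sy) /= => /eqP/eqP; apply/negP; exact: Up.
Qed.

Lemma zdense_nowhere_dense X U C x : zdense_in X U -> X x ->
  algebraic C -> C `<=` X `\` U -> nowhere_dense_at X C x.
Proof.
move=> dU Xx aC CU; apply: contrapT => nq.
have CX : vanishing_ideal C `<=` loc (evalat x) (vanishing_ideal X).
  by move=> q Cq; apply: contrapT => nXq; apply: nq; exists q.
have [s s0 sX] := loc_uniform (@noetherian_mpoly R n)
  (vanishing_ideal_ideal X) (vanishing_ideal_ideal C) CX.
have [|y [Uy [Xy sy]]] := dU _ (zopen_in_nonzero X s); first by exists x.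
suff /CU [_ //] : C y.
rewrite -(zeros_vanishing_ideal aC) => p /sX /(_ y Xy) /eqP.
by rewrite -evalatE rmorphM mulf_eq0 (negPf sy) /= => /eqP.
Qed.

Lemma nonvanishing_near X x F us p (e : R) : algebraic X -> X x ->
  regular_point X x F us -> ~ loc (evalat x) (vanishing_ideal X) p -> 0 < e ->
  exists y, [/\ X y, `|y - x| < e & peval p y != 0].
Proof.
move=> aX Xx [FX par szus XF] np e0.
have nP := @noetherian_mpoly R n.
have sFX : span F `<=` vanishing_ideal X.
  by apply: span_sub => //; exact: vanishing_ideal_ideal.
have nFp : ~ loc (evalat x) (span F) p by move=> /(loc_mono sFX).
(* In tangent dimension 0, [p] is nonzero at [x]; in dimensions 1 and 2 it is a unit times [v^k] on
   a curve [F' = 0] contained in [X] near [x]. *)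
have [px|[F' [v [s [w [k [par' FF' w0 Fp]]]]]]] : peval p x != 0 \/
  exists F' v s w k, [/\ params x (v :: F'), {subset F <= F'}, peval w x != 0 &
    span F' (s * p - w * v ^+ k)].
- case: us par szus => [|v [|u [|//]]] par _.
  + by left; apply/eqP => /(params_max par).
  + right; have v0 : peval v x = 0 by have [_ + _] := par; apply; rewrite mem_head.
    have hm q : peval q x = 0 -> loc (evalat x) (adjoin (span F) v) q.
      exact: params_max par.
    have [k [s [w [_ w0 Fp]]]] := dvr_order nP (span_ideal F) v0 hm nFp.
    by exists F, v, s, w, k; split.
  + right; have [h [s [w [k [par' s0 w0 Fp]]]]] := surface_expansion par nFp.
    exists (h :: F), v, s, w, k; split=> // q qF; by rewrite inE qF orbT.
- by exists x; rewrite subrr normr0.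
have [r r0 rX] := loc_uniform nP (span_ideal F) (vanishing_ideal_ideal X) XF.
have wr0 : peval (w * r) x != 0 by rewrite -evalatE rmorphM mulf_neq0.
have [d d0 hd] := peval_near_neq0 wr0.
have [|y [yx F'y vy]] := curve_points (e := Num.min d e) par'.
  by rewrite lt_min d0.
move: yx; rewrite lt_min => /andP [/hd + ye]; rewrite -evalatE rmorphM mulf_eq0 negb_or.
move=> /andP [wy ry]; exists y; split=> //.
  rewrite -(zeros_vanishing_ideal aX) => q /rX Fq.
  have /eqP : peval (r * q) y = 0.
    by apply: span_vanishing Fq => f /FF'; exact: F'y.
  by rewrite -evalatE rmorphM mulf_eq0 (negPf ry) => /eqP.
have /eqP : peval (s * p - w * v ^+ k) y = 0 by exact: span_vanishing Fp.
rewrite -evalatE rmorphB !rmorphM rmorphXn subr_eq0 /= => /eqP E.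
apply/eqP => py; move: E; rewrite [evalat y p]py mulr0 => /esym/eqP.
by rewrite mulf_eq0 (negPf wy) expf_eq0 (negPf vy) andbF.
Qed.

Definition has_limit U (G : 'rV[R]_n -> R) x (l : R) := forall e, 0 < e ->
  exists2 d, 0 < d & forall y, U y -> `|y - x| < d -> `|G y - l| < e.

Lemma quotient_limit U G x p q : peval q x != 0 ->
  (exists2 d, 0 < d & forall y, U y -> `|y - x| < d -> G y = peval p y / peval q y) ->
  has_limit U G x (peval p x / peval q x).
Proof.
move=> q0 [d d0 hG] e e0.
set q' := peval q x; have q'0 : 0 < `|q'| by rewrite normr_gt0.
pose r : P := p * mpoly.mpolyC n q' - mpoly.mpolyC n (peval p x) * q.
have rE y : peval r y = peval p y * q' - peval p x * peval q y.
  by rewrite /r /peval mpoly.mevalB !mpoly.mevalM !mpoly.mevalC.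
have rx : peval r x = 0 by rewrite rE subrr.
(* The difference of the quotients is [r(y) / (q' q(y))], and [|q(y)| > |q'| / 2] near [x]. *)
have e1 : 0 < e * (`|q'| * (`|q'| / 2)) by rewrite !mulr_gt0 // invr_gt0.
have [d1 d10 hr] := peval_near0 x r e1.
have q2 : 0 < `|q'| / 2 by rewrite divr_gt0.
have [d2 d20 hq] := peval_near0 x q q2.
exists (Num.min d (Num.min d1 d2)); first by rewrite !lt_min d0 d10.
move=> y Uy; rewrite !lt_min => /and3P [yd /hr + /hq qy]; rewrite rx subr0 => ry.
have qy2 : `|q'| / 2 < `|peval q y|.
  have := ler_distD (peval q y) q' 0; rewrite !subr0 distrC.
  by move=> h1; move: qy h1; rewrite -/q'; lra.
have qy0 : peval q y != 0 by rewrite -normr_gt0; exact: lt_trans qy2.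
rewrite hG //.
have -> : peval p y / peval q y - peval p x / q' = peval r y / (q' * peval q y).
  by rewrite rE; field; apply/andP; split.
rewrite normrM normfV ltr_pdivrMr ?normr_gt0 ?mulf_neq0 // normrM.
by apply: (lt_trans ry); rewrite !ltr_pM2l.
Qed.

Section RegularVariety.
Variables (X : set 'rV[R]_n) (aX : algebraic X).
Hypothesis regX : forall x, X x -> exists F us, regular_point X x F us.

Lemma zdense_near U x (e : R) : zopen_in X U -> zdense_in X U -> X x -> 0 < e ->
  exists2 y, U y & `|y - x| < e.
Proof.
move=> [V oV UV] dU Xx e0; have [F [us reg]] := regX Xx.
have aC : algebraic (X `&` ~` V) by exact: algebraicI.
have [|q Cq nq] := zdense_nowhere_dense dU Xx aC.
  by move=> y [Xy nVy]; split=> //; rewrite UV => -[].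
have [y [Xy yx qy]] := nonvanishing_near aX Xx reg nq e0.
exists y => //; rewrite UV; split=> //; apply: contrapT => nVy.
by move: qy; rewrite Cq ?eqxx.
Qed.

(** * Irreducible curves on a regular variety *)

Section Curve.
Variable C : set 'rV[R]_n.
Hypotheses (irrC : zirreducible C) (CX : C `<=` X).
Hypothesis ndC : forall x, C x -> nowhere_dense_at X C x.
Hypothesis nptC : forall a, ~ (C `<=` [set a]).

(** In tangent dimension 0 no nonzero local equation vanishes at [x]; in dimension 1 such an
    equation would reduce [C] to the point [x]. *)
Lemma curve_regular_point x : C x -> exists F u v q,
  [/\ regular_point X x F [:: v; u], vanishing_ideal C q &
      ~ loc (evalat x) (span F) q].
Proof.
move=> Cx; have [q Cq nXq] := ndC Cx; have [F [us reg]] := regX (CX Cx).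
have [FX par szus _] := reg.
have sFX : span F `<=` vanishing_ideal X.
  by apply: span_sub => //; exact: vanishing_ideal_ideal.
have nFq : ~ loc (evalat x) (span F) q by move=> /(loc_mono sFX).
case: us par szus reg => [|v [|u [|//]]] par _ reg.
- by case: nFq; apply: params_max par _; exact: Cq.
- case: (@nptC x); apply: (@dvr_prime_point _ _ _ _ (span F) v q) => //.
  + exact: span_ideal.
  + exact: zirreducible_prime.
  + exact: subset_trans (vanishing_ideal_sub CX).
  + by move=> p; exact: params_max par.
  + by have [_ + _] := par; apply; rewrite mem_head.
- by exists F, u, v, q.
Qed.

(** A second point of [D] would make the ideals of [C], [D] and [x] a strict chain of primes, which
    [height_le2] excludes. *)
Lemma proper_closed_point D x : zirreducible D -> D `<=` C -> D x ->
  ~ (vanishing_ideal D `<=` vanishing_ideal C) -> D `<=` [set x].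
Proof.
move=> irrD DC Dx nDC y Dy; apply/eqP; rewrite eq_sym; apply: contrapT => /negP.
move=> /neq_coordat [j zj]; apply: nDC.
have [F [u [v [q [[FX par _ _] Cq nFq]]]]] := curve_regular_point (DC _ Dx).
have [h [s [w [e [par' _ w0 Fq]]]]] := surface_expansion par nFq.
apply: (@height_le2 _ _ (evalat x) (span F) _ _ h v e s w q (coordat x j)) => //.
- exact: noetherian_mpoly.
- exact: span_ideal.
- exact: zirreducible_prime.
- exact: zirreducible_prime.
- apply: span_sub; first exact: vanishing_ideal_ideal.
  by move=> p /FX; exact: vanishing_ideal_sub.
- exact: vanishing_ideal_sub.
- by move=> p; apply.
- by have [_ + _] := par'; apply; rewrite !inE eqxx orbT.
- by rewrite evalatE peval_coordat subrr.
- by move=> /(_ y Dy) /eqP; rewrite (negPf zj).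
- by move=> p; exact: params_max par'.
Qed.

Lemma curve_zeros_finite p : algebraic C -> ~ vanishing_ideal C p ->
  exists S : seq 'rV[R]_n, forall x, C x -> peval p x = 0 -> x \in S.
Proof.
move=> aC np; have [|k [D [hD CE]]] := @irreducible_decomposition R n
  (C `&` [set x | peval p x = 0]).
  by apply: algebraicI => //; exact: algebraic_hypersurface.
have /choice [c cP] : forall i, exists c, (i < k)%N -> D i `<=` [set c].
  move=> i; have [ik|_] := boolP (i < k)%N; last by exists 0.
  have [_ irrD] := hD i ik; have [[a Da] _] := irrD; exists a => _.
  have DC b : D i b -> (C `&` [set x | peval p x = 0]) b by rewrite CE => Db; exists i.
  apply: proper_closed_point => //; first by move=> b /DC [].
  by move=> /(_ p) h; apply: np; apply: h => b /DC [].
exists [seq c i | i <- iota 0 k] => x Cx px.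
have : (C `&` [set x | peval p x = 0]) x by [].
rewrite CE => -[i ik Dx]; rewrite (cP i ik x Dx); apply: map_f.
by rewrite mem_iota.
Qed.

(* [g] is a uniformizer of the local ring of [X] along [C]. *)
Lemma curve_uniformizer : exists a g F,
  [/\ C a, vanishing_ideal C g, span F `<=` vanishing_ideal X,
      vanishing_ideal X `<=` loc (evalat a) (span F) &
      vanishing_ideal C `<=` loc (evalat a) (adjoin (span F) g)].
Proof.
have nP := @noetherian_mpoly R n.
have pC := zirreducible_prime irrC; have [hC pC'] := pC.
have [[a0 Ca0] _] := irrC.
have [F [u [v [q [[FX par _ XF] Cq nFq]]]]] := curve_regular_point Ca0.
have sFX : span F `<=` vanishing_ideal X.
  by apply: span_sub => //; exact: vanishing_ideal_ideal.
have [h [s [w [e [par' _ w0 Fq]]]]] := surface_expansion par nFq.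
have [g Cg nEg] := unstable_direction par' Ca0 w0 Fq Cq.
have [r r0 rX] := loc_uniform nP (span_ideal F) (vanishing_ideal_ideal X) XF.
(* [C] may be singular at [a0]. At [a] the derivative of [g] is nonzero, and [r] ensures that [F]
   still generates the ideal of [X]. *)
have [a Ca] : exists2 a, C a & peval (jacobian_derivation (h :: F) g * r) a != 0.
  apply: contrapT => na.
  have /pC' [//|/(_ a0 Ca0) /eqP] : vanishing_ideal C (jacobian_derivation (h :: F) g * r).
    by move=> a Ca; apply/eqP; apply: contrapT => /negP h'; apply: na; exists a.
  by rewrite (negPf r0).
rewrite -evalatE rmorphM mulf_eq0 negb_or => /andP [Ea ra].
exists a, g, F; split=> //; first by move=> p /rX; exists r.
have [sz _ _] := par'.
have gFC p : p \in g :: F -> vanishing_ideal C p.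
  by rewrite inE => /predU1P [->//|/FX]; exact: vanishing_ideal_sub.
have sgC : span (g :: F) `<=` vanishing_ideal C by exact: span_sub.
have para : params a [:: h - mpoly.mpolyC n (peval h a), g & F].
  apply: jacobian_derivation_params => //; by move=> p /gFC; apply.
set v' := h - _ in para.
have nCv : ~ vanishing_ideal C v'.
  move=> Cv; apply: (@nptC a); apply: coordat_point => j.
  apply: (@prime_loc _ _ _ (adjoin (span (g :: F)) v') a) => //.
    exact: adjoin_sub.
  by apply: (params_max para); rewrite peval_coordat subrr.
(* Any [y] in the ideal of [C] is locally [c v'] modulo [(g, F)]; this ideal is prime and does not
   contain [v'], so it contains [c]. *)
apply: (nakayama nP (span_ideal (g :: F)) hC) => y Cy.
have [t t0 [c Fc]] := params_max para (Cy a Ca).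
exists t, (v' * c); split=> //; last by rewrite (mulrC v').
apply: mem_max_mul; first by have [_ + _] := para; apply; rewrite mem_head.
have /pC' [//|//] : vanishing_ideal C (c * v').
by apply: (ideal_subr hC (sgC _ Fc)); exact: (idealMl _ hC Cy).
Qed.

End Curve.

(** The factorisation [p = (t / s) g^e] in the local ring of [X] along [C], where [s] and [t] are
    units, cleared of denominators. *)
Lemma curve_order C a g F p : C a -> span F `<=` vanishing_ideal X ->
  evalat a g = 0 ->
  vanishing_ideal C `<=` loc (evalat a) (adjoin (span F) g) ->
  ~ loc (evalat a) (vanishing_ideal X) p ->
  exists s t e, [/\ ~ vanishing_ideal C s, ~ vanishing_ideal C t &
    forall y, X y -> peval s y * peval p y = peval t y * peval g y ^+ e].
Proof.
move=> Ca sFX g0 Cg np.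
have nFp : ~ loc (evalat a) (span F) p by move=> /(loc_mono sFX).
have [e [s [t [s0 Fp nt]]]] :=
  adic_order (@noetherian_mpoly R n) (span_ideal F) g0 nFp.
exists s, t, e; split.
- by move=> /(_ a Ca) /eqP; apply/negP.
- by move=> /Cg.
- move=> y Xy; have /eqP := sFX _ Fp y Xy.
  by rewrite -evalatE rmorphB !rmorphM rmorphXn subr_eq0 /= => /eqP.
Qed.

(** * Limits of bounded quotients of polynomials *)

Section BoundedQuotient.
Variables (U : set 'rV[R]_n) (G : 'rV[R]_n -> R) (A B : P).
Hypotheses (oU : zopen_in X U) (dU : zdense_in X U).
Hypothesis B0 : forall y, U y -> peval B y != 0.
Hypothesis GE : forall y, U y -> G y = peval A y / peval B y.
Hypothesis bG : forall x, X x -> exists2 d, 0 < d &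
  exists M, forall y, U y -> `|y - x| < d -> `|G y| <= M.

Lemma sub_zopen_in : U `<=` X.
Proof. by have [V _ ->] := oU; move=> y []. Qed.

(** Points of [U] accumulate at [x], and at those points [p = q G] is a small factor times a bounded
    one. *)
Lemma bounded_quotient_zero x p q : X x -> peval q x = 0 ->
  (forall y, U y -> peval q y * G y = peval p y) -> peval p x = 0.
Proof.
move=> Xx q0 qG; apply/eqP; apply: contrapT => /negP p0.
have [d d0 [M hM]] := bG Xx.
have p2 : 0 < `|peval p x| / 2 by rewrite divr_gt0 ?normr_gt0.
have [d1 d10 hp] := peval_near0 x p p2.
have M1 : 0 < `|M| + 1 by rewrite ltr_wpDl.
have [d2 d20 hq] := peval_near0 x q (divr_gt0 p2 M1).
have [|y Uy] := zdense_near (e := Num.min d (Num.min d1 d2)) oU dU Xx.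
  by rewrite !lt_min d0 d10.
rewrite !lt_min => /and3P [/(hM y Uy) GM /hp py /hq]; rewrite q0 subr0 => qy.
have : `|peval p y| <= `|peval p x| / 2.
  rewrite -qG // normrM -[leRHS](divfK (lt0r_neq0 M1)).
  apply: ler_pM => //; first exact: ltW.
  by rewrite (le_trans GM) // (le_trans (ler_norm M)) // lerDl.
have := ler_distD (peval p y) (peval p x) 0; rewrite !subr0 distrC.
move=> h1 h2; move: py h1 h2; lra.
Qed.

(** Let [B] and [A] have orders [e] and [e'] along [C]. If [e' < e], boundedness would make [s t']
    vanish where it does not; otherwise [g^e] cancels and leaves a denominator with finitely many
    zeros on [C]. *)
Lemma bounded_quotient_limit_curve C : algebraic C -> zirreducible C ->
  C `<=` X `\` U -> exists S : seq 'rV[R]_n,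
    forall x, C x -> x \notin S -> exists l, has_limit U G x l.
Proof.
move=> aC irrC CXU; have CX : C `<=` X by move=> y /CXU [].
have [[a Ca]|npt] := pselect (exists a, C `<=` [set a]).
  by exists [:: a] => x /Ca ->; rewrite mem_head.
have nptC a : ~ (C `<=` [set a]) by move=> Ca; apply: npt; exists a.
have ndC x : C x -> nowhere_dense_at X C x.
  by move=> Cx; exact: zdense_nowhere_dense dU (CX _ Cx) aC CXU.
have [a [g [F [Ca Cg sFX XF Cgen]]]] := curve_uniformizer irrC CX ndC nptC.
have g0 : evalat a g = 0 by exact: Cg.
have [hC pC] := zirreducible_prime irrC.
have nB := zdense_nonvanishing dU (CX _ Ca) B0.
have [s [t [e [nCs nCt stE]]]] := curve_order Ca sFX g0 Cgen nB.
(* If [A] is zero on [X] near [a], it has no order, but [G] is then 0 off the zeros of [r]. *)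
have [[r r0 Xr]|nA] := pselect (loc (evalat a) (vanishing_ideal X) A).
  have [|S hS] := curve_zeros_finite irrC CX ndC nptC (p := r) aC.
    by move=> /(_ a Ca) /eqP; apply/negP.
  exists S => x Cx xS; exists (peval (0 : P) x / peval (1 : P) x).
  apply: quotient_limit; first by rewrite -evalatE rmorph1 oner_neq0.
  have [|d d0 hd] := @peval_near_neq0 R n x r.
    by apply: contraNneq xS; exact: hS.
  exists d => // y Uy /hd ry; rewrite GE //.
  have /eqP := Xr y (sub_zopen_in Uy).
  rewrite -evalatE rmorphM mulf_eq0 (negPf ry) /= => /eqP Ay.
  by rewrite [peval A y]Ay -(evalatE y 0) rmorph0 !mul0r.
have [s' [t' [e' [nCs' nCt' stE']]]] := curve_order Ca sFX g0 Cgen nA.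
have nw : ~ vanishing_ideal C (s * t * (s' * t')).
  by move=> /pC [/pC [//|//]|/pC [//|//]].
have [S hS] := curve_zeros_finite irrC CX ndC nptC aC nw.
have wP x : C x -> x \notin S ->
    [/\ peval s x != 0, peval t x != 0, peval s' x != 0 & peval t' x != 0].
  move=> Cx xS; have : peval (s * t * (s' * t')) x != 0.
    by apply: contraNneq xS; exact: hS.
  rewrite -evalatE !rmorphM !mulf_eq0 !negb_or => /andP [/andP [? ?] /andP [? ?]].
  by split.
have main y : U y -> peval s' y * peval t y * peval g y ^+ e * G y =
    peval s y * peval t' y * peval g y ^+ e'.
  move=> Uy; have Xy := sub_zopen_in Uy; have By := B0 Uy.
  rewrite -!mulrA -stE' // GE //.
  have -> : peval s' y * (peval t y * (peval g y ^+ e * (peval A y / peval B y))) =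
    peval s' y * (peval t y * peval g y ^+ e) * (peval A y / peval B y) by ring.
  by rewrite -stE //; field.
exists S => x Cx xS; have [sx tx s'x t'x] := wP x Cx xS.
have [lee|lte] := leqP e e'; last first.
  have qG y : U y -> peval (s' * t * g ^+ (e - e')) y * G y = peval (s * t') y.
    move=> Uy; rewrite -!evalatE !rmorphM rmorphXn /=.
    (* If [g] vanishes at [y], so does [s], because [B] does not; both sides are then 0. *)
    have [gy|gy] := eqVneq (peval g y) 0.
      have := stE y (sub_zopen_in Uy); rewrite gy expr0n gtn_eqF ?(leq_ltn_trans _ lte) //=.
      rewrite mulr0 => /eqP; rewrite mulf_eq0 (negPf (B0 Uy)) orbF => /eqP sy.
      by rewrite [evalat y g]gy [evalat y s]sy expr0n subn_eq0 leqNgt lte mulr0 !mul0r.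
    apply: (mulIf (expf_neq0 e' gy)); rewrite -main // -[in RHS](subnK (ltnW lte)) exprD.
    by rewrite !evalatE; ring.
  suff /eqP : peval (s * t') x = 0.
    by rewrite -evalatE rmorphM mulf_eq0 (negPf sx) (negPf t'x).
  apply: (@bounded_quotient_zero x _ (s' * t * g ^+ (e - e'))) => //; first exact: CX.
  rewrite -evalatE !rmorphM rmorphXn /= [evalat x g](Cg _ Cx).
  by rewrite expr0n subn_eq0 leqNgt lte mulr0.
exists (peval (s * t' * g ^+ (e' - e)) x / peval (s' * t) x).
apply: quotient_limit; first by rewrite -evalatE rmorphM mulf_neq0.
have [|d d0 hd] := @peval_near_neq0 R n x (s * (s' * t)); last first.
  exists d => // y Uy /hd; rewrite -!evalatE !rmorphM rmorphXn /= !mulf_eq0 !negb_or.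
  move=> /andP [sy /andP [s'y ty]].
  have gy : peval g y ^+ e != 0.
    apply/eqP => gy; have /eqP := stE y (sub_zopen_in Uy).
    by rewrite gy mulr0 mulf_eq0 (negPf sy) (negPf (B0 Uy)).
  apply: (mulIf (mulf_neq0 (mulf_neq0 s'y ty) gy)); rewrite mulrC main // !evalatE.
  by rewrite -{1}(subnK lee) exprD; field; apply/andP; split.
by rewrite -evalatE !rmorphM !mulf_neq0.
Qed.

Theorem bounded_quotient_limit : exists S : seq 'rV[R]_n,
  forall x, X x -> x \notin S -> exists l, has_limit U G x l.
Proof.
have [V oV UV] := oU.
have [k [C [hC CE]]] := irreducible_decomposition (algebraicI aX oV).
have CU i : (i < k)%N -> C i `<=` X `\` U.
  move=> ik y Cy; have : (X `&` ~` V) y by rewrite CE; exists i.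
  by move=> [Xy nVy]; split=> //; rewrite UV => -[].
have /choice [S SP] : forall i, exists S : seq 'rV[R]_n, (i < k)%N ->
    forall x, C i x -> x \notin S -> exists l, has_limit U G x l.
  move=> i; have [ik|_] := boolP (i < k)%N; last by exists [::].
  have [aC irrC] := hC i ik.
  by have [S SP] := bounded_quotient_limit_curve aC irrC (CU i ik); exists S.
exists (flatten [seq S i | i <- iota 0 k]) => x Xx xS.
have [Ux|nUx] := pselect (U x).
  exists (peval A x / peval B x); apply: quotient_limit; first exact: B0.
  by exists 1 => // y Uy _; exact: GE.
have : (X `&` ~` V) x by split=> // Vx; apply: nUx; rewrite UV.
rewrite CE => -[i ik Cx]; apply: (SP i ik x Cx).
apply: contra xS => xS; apply/flattenP; exists (S i) => //.
by apply: map_f; rewrite mem_iota.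
Qed.

End BoundedQuotient.

End RegularVariety.
End Extension.

(** * Limits, interpolation and global fractions *)

Section Limits.
Variables (R : realType) (n : nat).
Local Notation P := (mpoly.mpoly n R).
Implicit Types (U X : set 'rV[R]_n) (x : 'rV[R]_n) (G : 'rV[R]_n -> R) (p : P).

Lemma has_limitP U G x l : has_limit U G x l <-> (G y @[y --> within U (nbhs x)] --> l).
Proof.
split=> [h|/(@cvgrPdist_lt R R^o _ (within U (nbhs x))) h e e0].
  apply/(@cvgrPdist_lt R R^o _ (within U (nbhs x))) => e e0.
  have [d d0 hd] := h e e0.
  apply/(@nbhs_normP R 'rV[R]_n x); exists d => //= y yd Uy.
  by rewrite distrC; apply: hd => //; rewrite distrC.
have /(@nbhs_normP R 'rV[R]_n x) [d /= d0 hd] := h e e0.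
exists d => // y Uy yd; rewrite distrC; apply: hd => //=.
by rewrite distrC.
Qed.

Lemma has_limitD U G G' x l l' : has_limit U G x l -> has_limit U G' x l' ->
  has_limit U (fun y => G y + G' y) x (l + l').
Proof.
move=> /has_limitP h /has_limitP h'; apply/has_limitP.
exact: (cvgD h h').
Qed.
Lemma has_limitM U G G' x l l' : has_limit U G x l -> has_limit U G' x l' ->
  has_limit U (fun y => G y * G' y) x (l * l').
Proof.
move=> /has_limitP h /has_limitP h'; apply/has_limitP.
exact: (cvgM h h').
Qed.
Lemma within_continuousP (X : set 'rV[R]_n) (g : 'rV[R]_n -> R) :
  {within X, continuous g} <-> forall x, X x -> has_limit X g x (g x).
Proof.
split=> [/subspace_continuousP h x Xx|h]; first by apply/has_limitP; exact: h.
by apply/subspace_continuousP => x Xx; apply/has_limitP; exact: h.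
Qed.

Lemma has_limit_cst U x c : has_limit U (fun=> c) x c.
Proof. by move=> e e0; exists 1 => // y _ _; rewrite subrr normr0. Qed.

Lemma has_limit_sum U (I : finType) (G : I -> 'rV[R]_n -> R) x (l : I -> R) :
  (forall i, has_limit U (G i) x (l i)) ->
  has_limit U (fun y => \sum_i G i y) x (\sum_i l i).
Proof.
move=> Gl; elim: (index_enum I) => [|i s IHs].
  rewrite big_nil; under [X in has_limit _ X]eq_fun do rewrite big_nil.
  exact: has_limit_cst.
rewrite big_cons; under [X in has_limit _ X]eq_fun do rewrite big_cons.
exact: has_limitD.
Qed.

Lemma has_limit_peval U x p : has_limit U (peval p) x (peval p x).
Proof. by move=> e /(peval_near0 x p) [d d0 hd]; exists d => // y _; exact: hd. Qed.

Lemma has_limit_sub U V G x l : V `<=` U -> has_limit U G x l -> has_limit V G x l.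
Proof.
by move=> VU h e /h [d d0 hd]; exists d => // y /VU; exact: hd.
Qed.

Lemma has_limit_ext U G G' x l : {in U, G =1 G'} -> has_limit U G x l -> has_limit U G' x l.
Proof.
move=> GG' h e /h [d d0 hd]; exists d => // y Uy.
by rewrite -GG' ?inE //; exact: hd.
Qed.

Lemma has_limit_unique U G x l l' :
  (forall e, 0 < e -> exists2 y, U y & `|y - x| < e) ->
  has_limit U G x l -> has_limit U G x l' -> l = l'.
Proof.
move=> near h h'; apply/eqP; rewrite -subr_eq0 -normr_eq0; apply: contrapT => /negP ll'.
have e0 : 0 < `|l - l'| / 2 by rewrite divr_gt0 // lt0r ll' normr_ge0.
have [d d0 hd] := h _ e0; have [d' d'0 hd'] := h' _ e0.
have [|y Uy] := near (Num.min d d'); first by rewrite lt_min d0.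
rewrite lt_min => /andP [/(hd y Uy) h1 /(hd' y Uy) h2].
have := ler_distD (G y) l l'; rewrite [`|l - G y|]distrC => h3.
move: h1 h2 h3; lra.
Qed.

Lemma has_limit_extension U X G g :
  (forall x, X x -> forall e, 0 < e -> exists2 y, U y & `|y - x| < e) ->
  (forall x, X x -> has_limit U G x (g x)) -> {within X, continuous g}.
Proof.
move=> near h; apply/within_continuousP => x Xx e e0.
have e2 : 0 < e / 2 by rewrite divr_gt0.
have [d d0 hd] := h x Xx _ e2; exists (d / 2) => [|z Xz zx]; first by rewrite divr_gt0.
have [d' d'0 hd'] := h z Xz _ e2.
have [|y Uy] := near z Xz (Num.min (d / 2) d'); first by rewrite lt_min divr_gt0.
rewrite lt_min => /andP [yz /(hd' y Uy) Gz].
have /(hd y Uy) Gx : `|y - x| < d.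
  apply: (le_lt_trans (ler_distD z y x)); move: yz zx; lra.
have := ler_distD (G y) (g z) (g x); rewrite [`|g z - G y|]distrC => h3.
move: Gz Gx h3; lra.
Qed.

Lemma interpolation (S : seq 'rV[R]_n) (c : 'rV[R]_n -> R) :
  exists p : P, forall a, a \in S -> peval p a = c a.
Proof.
elim: S => [|b S [p pE]]; first by exists 0.
have [bS|bS] := boolP (b \in S).
  by exists p => a; rewrite inE => /predU1P [->|]; exact: pE.
(* A product of squared distances, zero on [S] and nonzero at [b]. *)
pose q : P := \prod_(a <- S) \sum_i coordat a i ^+ 2.
have qE y : peval q y = \prod_(a <- S) \sum_i (y ord0 i - a ord0 i) ^+ 2.
  rewrite -evalatE rmorph_prod; apply: eq_bigr => a _.
  rewrite rmorph_sum; apply: eq_bigr => i _.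
  by rewrite rmorphXn /= evalatE peval_coordat.
have q0 a : a \in S -> peval q a = 0.
  move=> aS; rewrite qE (big_rem a) //= big1 ?mul0r // => i _.
  by rewrite subrr expr0n.
have qb : peval q b != 0.
  rewrite qE prodf_seq_neq0; apply/allP => a aS /=.
  apply/eqP => /eqP; rewrite psumr_eq0 => [/allP h|i _]; last exact: sqr_ge0.
  move: bS; suff -> : b = a by rewrite aS.
  apply/rowP => i; have := h i (mem_index_enum i).
  by rewrite /= sqrf_eq0 subr_eq0 => /eqP.
exists (p + mpoly.mpolyC n ((c b - peval p b) / peval q b) * q) => a.
rewrite -evalatE rmorphD rmorphM /= !evalatE [peval (mpoly.mpolyC _ _) a]mpoly.mevalC.
rewrite inE => /predU1P [->|aS]; first by rewrite divfK // addrC subrK.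
by rewrite (q0 a aS) mulr0 addr0 pE.
Qed.

(** The generators of the ideal of denominators of [G] have no common zero on [U]; over the reals
    the sum of their squares is then a single denominator without zeros there. *)
Lemma regular_quotient U G : regular_on U G ->
  exists A B, forall y, U y -> peval B y != 0 /\ G y = peval A y / peval B y.
Proof.
move=> regG.
pose J : set P := [set B | exists A, forall y, U y -> peval B y * G y = peval A y].
have hJ : is_ideal J.
  split.
  - exists 0 => y _; have p0 : peval (0 : P) y = 0 by exact: (rmorph0 (evalat y)).
    by rewrite p0 mul0r.
  - move=> p q [A hA] [B hB]; exists (A + B) => y Uy.
    by rewrite -!evalatE !rmorphD /= mulrDl !evalatE hA // hB.
  - move=> a p [A hA]; exists (a * A) => y Uy.
    by rewrite -!evalatE !rmorphM /= -mulrA !evalatE hA.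
have [s sE] := noetherian_mpoly hJ.
have sJ b : b \in s -> J b by move=> bs; rewrite sE; exact: mem_span.
have [A hA] : J (\sum_(i < size s) s`_i * s`_i).
  by apply: ideal_sum => // i _; apply: idealMl => //; apply: sJ; exact: mem_nth.
exists A, (\sum_(i < size s) s`_i * s`_i) => y Uy.
suff B0 : peval (\sum_(i < size s) s`_i * s`_i) y != 0.
  by split=> //; rewrite -hA // mulrC mulKf.
have [V [p [q [[W [S aW] ->] [_ Wy] hpq]]]] := regG y Uy.
have [t St ty] : exists2 t, S t & peval t y != 0.
  apply: contrapT => nt; have : (~` W) y.
    rewrite aW => t St; apply: contrapT => /eqP ty; by apply: nt; exists t.
  by apply.
(* [t] vanishes off [W], so [t q] is a denominator on all of [U], and it is nonzero at [y]. *)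
have Jtq : J (t * q).
  exists (t * p) => z Uz; rewrite -!evalatE !rmorphM /= !evalatE.
  have [Wz|nWz] := pselect (W z).
    by have [q0 ->] := hpq z (conj Uz Wz); rewrite -mulrA (mulrC (peval q z)) divfK.
  have tz : peval t z = 0 by have : (~` W) z by []; rewrite aW; apply.
  by rewrite tz !mul0r.
have [i si] : exists i : 'I_(size s), peval s`_i y != 0.
  apply: contrapT => ni; have [q0 _] := hpq y (conj Uy Wy).
  have /eqP : peval (t * q) y = 0.
    apply: (@span_vanishing _ _ s); last by rewrite -sE.
    move=> b /(nthP 0) [i lti <-]; apply/eqP; apply: contrapT => /negP h.
    by apply: ni; exists (Ordinal lti).
  by rewrite -evalatE rmorphM mulf_eq0 (negPf ty) (negPf q0).
rewrite -evalatE rmorph_sum psumr_eq0 => [|j _]; last by rewrite rmorphM -expr2 sqr_ge0.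
apply/allPn; exists i; first exact: mem_index_enum.
by rewrite /= rmorphM mulf_neq0.
Qed.

Lemma zopen_inI X U V : zopen_in X U -> zopen_in X V -> zopen_in X (U `&` V).
Proof.
move=> [U' oU ->] [V' oV ->]; exists (U' `&` V'); last by rewrite setIACA setIid.
by rewrite /zopen setCI; exact: algebraicU.
Qed.

Lemma zopen_in_self X : zopen_in X X.
Proof. by exists setT; rewrite ?setIT // /zopen setCT; exact: algebraic0. Qed.

Lemma zdense_inI X U V : zopen_in X V -> zdense_in X U -> zdense_in X V ->
  zdense_in X (U `&` V).
Proof.
move=> oV dU dV W oW /(dV W oW) VW.
have [|x [Ux [Vx Wx]]] := dU (V `&` W) _ VW; first exact: zopen_inI.
by exists x.
Qed.

Lemma common_domain X r (f : 'I_r -> 'rV[R]_n -> R) :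
  (forall i, continuous_rational X (f i)) -> exists U, [/\ zopen_in X U, zdense_in X U &
    forall i, exists A B, forall y, U y -> peval B y != 0 /\ f i y = peval A y / peval B y].
Proof.
move=> hf.
suff aux k : (k <= r)%N -> exists U, [/\ zopen_in X U, zdense_in X U &
    forall i : 'I_r, (i < k)%N ->
    exists A B, forall y, U y -> peval B y != 0 /\ f i y = peval A y / peval B y].
  by have [U [oU dU UP]] := aux r (leqnn r); exists U; split=> // i; exact: UP.
elim: k => [_|k IHk ltkr].
  exists X; split=> //; first exact: zopen_in_self.
  by move=> V [W _ ->] [x [Xx Wx]]; exists x.
have [U [oU dU UP]] := IHk (ltnW ltkr).
have [_ [V [oV dV /regular_quotient [A [B AB]]]]] := hf (Ordinal ltkr).
exists (U `&` V); split; [exact: zopen_inI|exact: zdense_inI|].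
move=> i; rewrite ltnS leq_eqVlt => /predU1P [ik|ik].
  have -> : i = Ordinal ltkr by exact: val_inj.
  by exists A, B => y [_]; exact: AB.
by have [A' [B' AB']] := UP i ik; exists A', B' => y [Uy _]; exact: AB'.
Qed.

End Limits.

(** * Continuous rational solutions *)

Section FractionDomain.
Variables (R : realType) (n : nat).
Local Notation P := (mpoly.mpoly n R).
Implicit Types (W X : set 'rV[R]_n) (s : P).

(** The nonvanishing locus of [s] need not be dense, since [s] may vanish on a whole component of
    [X]; the points where [s] is locally zero on [X] are therefore added. *)
Definition fraction_domain X W s : set 'rV[R]_n :=
  W `&` [set y | peval s y != 0 \/ loc (evalat y) (vanishing_ideal X) s].

Lemma fraction_domain_zopen X W s : zopen_in X W -> zopen_in X (fraction_domain X W s).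
Proof.
move=> [V oV ->].
exists (V `&` [set y | peval s y != 0 \/ loc (evalat y) (vanishing_ideal X) s]).
  rewrite /zopen setCI; apply: algebraicU => //.
  (* The complement is cut out by [s] and the polynomials that annihilate [s] modulo the ideal of
     [X]. *)
  exists [set p | p = s \/ vanishing_ideal X (p * s)]; rewrite eqEsubset; split=> y /=.
    move=> /not_orP [/negP]; rewrite negbK => /eqP sy ny p [->//|Xps].
    apply: contrapT => /eqP py; apply: ny; by exists p.
  move=> h [|[p p0 Xps]]; first by rewrite h ?eqxx //; left.
  by move: p0; rewrite evalatE h ?eqxx //; right.
by rewrite /fraction_domain setIA.
Qed.

Lemma fraction_domain_zdense X W s : zopen_in X W -> zdense_in X W ->
  zdense_in X (fraction_domain X W s).
Proof.
move=> oW dW V oV /(dW V oV) [y [Wy Vy]].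
have [T oT VWT] := zopen_inI oW oV.
have [[z [VWz sz]]|ns] := pselect (exists z, (W `&` V) z /\ peval s z != 0).
  by exists z; have [Wz Vz] := VWz; split=> //; split=> //; left.
exists y; split=> //; split=> //; right.
have [S aT] := oT; have [Xy Ty] : (X `&` T) y by rewrite -VWT.
have [t St ty] : exists2 t, S t & peval t y != 0.
  apply: contrapT => nt; suff : (~` T) y by apply.
  rewrite aT => t St; apply: contrapT => /eqP ty; by apply: nt; exists t.
exists t => // z Xz; rewrite -evalatE rmorphM /= !evalatE.
have [Tz|nTz] := pselect (T z); last first.
  have tz : peval t z = 0 by have : (~` T) z by []; rewrite aT; apply.
  by rewrite tz mul0r.
have VWz : (W `&` V) z by rewrite VWT.
have -> : peval s z = 0; last by rewrite mulr0.
by apply: contrapT => /eqP sz; apply: ns; exists z.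
Qed.

(* Where [s] vanishes identically near [y] the quotient is [0], because [x / 0 = 0]. *)
Lemma fraction_regular X W s (A B C : P) (G : 'rV[R]_n -> R) : zopen_in X W ->
  (forall y, W y -> peval B y != 0) ->
  (forall y, fraction_domain X W s y ->
     G y = peval A y / (peval B y * peval s y) + peval C y) ->
  regular_on (fraction_domain X W s) G.
Proof.
set U := fraction_domain X W s => oW B0 GE x Ux.
have [V' _ WV'] := oW.
have WX : W `<=` X by rewrite WV' => y [].
have UW : U `<=` W by move=> y [].
have [Wx [sx|[t t0 Xts]]] := Ux.
  exists (U `&` [set y | peval (B * s) y != 0]), (A + C * (B * s)), (B * s).
  split; first exact: zopen_in_nonzero.
    by split=> //=; rewrite -evalatE rmorphM mulf_neq0 //; exact: B0.
  move=> y [Uy] /= Bs0; split=> //; rewrite GE //.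
  move: (Bs0); rewrite -!evalatE rmorphD !rmorphM /= mulf_eq0 negb_or => /andP [By sy].
  by rewrite !evalatE; field; apply/andP; split.
exists (U `&` [set y | peval t y != 0]), C, 1; split.
- exact: zopen_in_nonzero.
- by split.
- move=> y [Uy] /= ty; rewrite -(evalatE y 1) rmorph1 oner_neq0 divr1; split=> //.
  have /eqP := Xts y (WX _ (UW _ Uy)).
  rewrite -evalatE rmorphM mulf_eq0 (negPf ty) /= => /eqP sy.
  by rewrite GE // [peval s y]sy mulr0 invr0 mulr0 add0r.
Qed.

End FractionDomain.

(** * The orthogonal projection onto the line of a vector *)

Section Quotients.
Variables (K : realFieldType) (r : nat) (f : 'I_r -> K).
Let N := \sum_k f k ^+ 2.

Lemma sqr_le_sum j : f j ^+ 2 <= N.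
Proof. by rewrite /N (bigD1 j) //= lerDl sumr_ge0 // => i _; rewrite sqr_ge0. Qed.

Lemma sum_sqr_eq0 j : N = 0 -> f j = 0.
Proof.
move=> N0; apply/eqP; rewrite -sqrf_eq0 eq_le sqr_ge0 andbT -N0.
exact: sqr_le_sum.
Qed.

Lemma norm_quotient_le1 j i : `|f j * f i / N| <= 1.
Proof.
have [N0|N0] := eqVneq N 0; first by rewrite N0 invr0 mulr0 normr0.
have Ngt : 0 < N by rewrite lt0r N0 sumr_ge0 // => k _; rewrite sqr_ge0.
rewrite normrM normfV (gtr0_norm Ngt) ler_pdivrMr // mul1r.
have := sqr_le_sum j; have := sqr_le_sum i; rewrite ler_norml => hi hj.
by apply/andP; split; nra.
Qed.

(** The matrix [f j * f i / N] is the projection onto the line of [f], so it fixes [f]; if [N = 0],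
    then [f = 0] as well. *)
Lemma sum_quotient j : \sum_i f j * f i / N * f i = f j.
Proof.
have [N0|N0] := eqVneq N 0.
  by rewrite big1 => [|i _]; rewrite ?(sum_sqr_eq0 _ N0) // mulr0.
transitivity (f j / N * N); last by rewrite divfK.
by rewrite [in RHS]/N mulr_sumr; apply: eq_bigr => i _; ring.
Qed.

End Quotients.

Section Main.
Variables (R : realType) (n : nat).
Local Notation P := (mpoly.mpoly n R).
Implicit Types (U X : set 'rV[R]_n) (x : 'rV[R]_n) (G : 'rV[R]_n -> R).

Lemma has_limit_squeeze U G H x : (forall y, U y -> `|G y| <= H y) ->
  has_limit U H x 0 -> has_limit U G x 0.
Proof.
move=> GH h e /h [d d0 hd]; exists d => // y Uy /(hd y Uy).
rewrite !subr0; apply: le_lt_trans.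
by rewrite (le_trans (GH y Uy)) // ler_norm.
Qed.

Lemma has_limit_norm U G x l : has_limit U G x l -> has_limit U (fun y => `|G y|) x `|l|.
Proof.
move=> h e /h [d d0 hd]; exists d => // y Uy /(hd y Uy).
by apply: le_lt_trans; exact: ler_dist_dist.
Qed.

Lemma has_limitN U G x l : has_limit U G x l -> has_limit U (fun y => - G y) x (- l).
Proof.
move=> h e /h [d d0 hd]; exists d => // y Uy /(hd y Uy).
by rewrite -opprD normrN.
Qed.

Lemma common_denominator U r (f : 'I_r -> 'rV[R]_n -> R) :
  (forall i, exists A B : P, forall y, U y -> peval B y != 0 /\ f i y = peval A y / peval B y) ->
  exists (C : 'I_r -> P) (D : P), forall y, U y ->
    peval D y != 0 /\ forall i, f i y = peval (C i) y / peval D y.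
Proof.
move=> hf.
have /choice [A /choice [B AB]] := hf.
exists (fun i => A i * \prod_(j | j != i) B j), (\prod_j B j) => y Uy.
have B0 j : peval (B j) y != 0 by have [] := AB j y Uy.
split; first by rewrite -evalatE rmorph_prod; apply/prodf_neq0 => j _; exact: B0.
move=> i; have [_ ->] := AB i y Uy.
rewrite [\prod_j B j](bigD1 i) //= -!evalatE !rmorphM /= !evalatE.
have : peval (\prod_(j | j != i) B j) y != 0.
  by rewrite -evalatE rmorph_prod; apply/prodf_neq0 => j _; exact: B0.
by set q := peval _ y => Q0; field; rewrite Q0 B0.
Qed.

Lemma continuous_rational_solution X r (f psi : 'I_r -> 'rV[R]_n -> R)
    (phi : 'rV[R]_n -> R) :
  algebraic_surface X -> nonsingular X ->
  (forall i, continuous_rational X (f i)) -> continuous_rational X phi ->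
  (forall i, {within X, continuous (psi i)}) ->
  (forall x, X x -> phi x = \sum_(i < r) psi i x * f i x) ->
  exists2 g : 'I_r -> 'rV[R]_n -> R, (forall i, continuous_rational X (g i)) &
    (forall x, X x -> phi x = \sum_(i < r) g i x * f i x).
Proof.
move=> hX hns hf hphi cpsi phiE.
have [aX _] := hX; have regX x (Xx : X x) := surface_regular_point hX hns Xx.
have [W1 [oW1 dW1 /common_denominator [C [D CD]]]] := common_domain hf.
have [cphi [W2 [oW2 dW2 /regular_quotient [A [B AB]]]]] := hphi.
pose W := W1 `&` W2; have oW : zopen_in X W by exact: zopen_inI.
have dW : zdense_in X W by exact: zdense_inI.
(* On [W], [s] is [N] times the square of the common denominator [D], so [1 / N = D^2 / s] even
   where both are 0. *)
pose s := \sum_i C i ^+ 2; pose U := fraction_domain X W s.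
have oU : zopen_in X U by exact: fraction_domain_zopen.
have dU : zdense_in X U by exact: fraction_domain_zdense.
have UX : U `<=` X by have [V _ ->] := oU; move=> y [].
have UW : U `<=` W by move=> y [].
have nearU x (Xx : X x) e := @zdense_near R n X aX regX U x e oU dU Xx.
pose N y := \sum_k f k y ^+ 2.
pose Q j i y := f j y * f i y / N y.
have NE y : W y -> (N y)^-1 = peval D y ^+ 2 * (peval s y)^-1.
  move=> [/CD [D0 fE] _].
  have -> : N y = peval s y / peval D y ^+ 2.
    rewrite -evalatE rmorph_sum mulr_suml; apply: eq_bigr => k _.
    by rewrite rmorphXn /= fE expr_div_n.
  by rewrite invfM invrK mulrC.
have regQ j i : regular_on U (Q j i).
  apply: (@fraction_regular _ _ X W s (C j * C i) 1 0) => // [y _|y /UW Wy].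
    by rewrite -evalatE rmorph1 oner_neq0.
  have [/CD [D0 fE] _] := Wy.
  rewrite /Q NE // !fE -!evalatE rmorphM rmorph1 rmorph0 /= addr0 mul1r.
  by set z := (evalat y s)^-1; rewrite !evalatE; field.
(* Arbitrary [T] and [S] let this serve twice: with zeros for the uncorrected quotient, with the
   interpolating polynomials for the corrected one. *)
have regphi i (T : 'I_r -> P) (S : P) : regular_on U (fun y =>
    phi y * f i y / N y + \sum_j peval (- T j) y * Q j i y + peval S y).
  apply: (@fraction_regular _ _ X W s
    ((A * D - B * \sum_j T j * C j) * C i) B S) => //.
    by move=> y [_ /AB []].
  move=> y /UW Wy; have [/CD [D0 fE] /AB [B0 phiE']] := Wy.
  congr (_ + _).
  have -> : \sum_j peval (- T j) y * Q j i y =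
      - (\sum_j peval (T j) y * peval (C j) y) * (peval (C i) y / peval s y).
    rewrite mulNr mulr_suml -sumrN; apply: eq_bigr => j _.
    rewrite /Q NE // !fE -!evalatE rmorphN /=.
    by set z := (evalat y s)^-1; rewrite !evalatE; field.
  have -> : \sum_j peval (T j) y * peval (C j) y = peval (\sum_j T j * C j) y.
    by rewrite -[RHS]evalatE rmorph_sum; apply: eq_bigr => j _; rewrite rmorphM.
  rewrite NE // phiE' fE -!evalatE rmorphM rmorphB !rmorphM /= invfM.
  by set z := (evalat y s)^-1; rewrite !evalatE; field; apply/andP; split.
have psilim i x : X x -> has_limit U (psi i) x (psi i x).
  by move=> Xx; apply: (has_limit_sub UX); have /within_continuousP := cpsi i; apply.
have quotE i y : X y -> phi y * f i y / N y = \sum_j psi j y * Q j i y.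
  move=> Xy; rewrite phiE // !mulr_suml; apply: eq_bigr => j _; rewrite /Q; ring.
have limQ j i : exists S : seq 'rV[R]_n,
    forall x, X x -> x \notin S -> exists l, has_limit U (Q j i) x l.
  have [A' [B' AB']] := regular_quotient (regQ j i).
  apply: (@bounded_quotient_limit _ _ X aX regX U _ A' B') => //.
  - by move=> y /AB' [].
  - by move=> y /AB' [].
  - move=> x _; exists 1 => //; exists 1 => y _ _.
    exact: (norm_quotient_le1 (fun k => f k y)).
have limphi i : exists S : seq 'rV[R]_n, forall x, X x -> x \notin S ->
    exists l, has_limit U (fun y => phi y * f i y / N y) x l.
  have := regphi i (fun=> 0) 0; set G := (X in regular_on U X) => regG.
  have GE y : G y = phi y * f i y / N y.
    rewrite /G big1 => [|j _].
      by rewrite addr0 -(evalatE y 0) rmorph0 addr0.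
    by rewrite oppr0 -(evalatE y 0) rmorph0 mul0r.
  have <- : G = fun y => phi y * f i y / N y by apply: funext.
  have [A' [B' AB']] := regular_quotient regG.
  apply: (@bounded_quotient_limit _ _ X aX regX U _ A' B') => //.
  - by move=> y /AB' [].
  - by move=> y /AB' [].
  - move=> x Xx.
    have /(_ 1 ltr01) [d d0 hd] : has_limit U (fun y => \sum_j `|psi j y|) x
        (\sum_j `|psi j x|).
      by apply: has_limit_sum => j; apply: has_limit_norm; exact: psilim.
    exists d => //; exists (\sum_j `|psi j x| + 1) => y Uy /(hd y Uy) h.
    rewrite GE quotE; last exact: UX.
    rewrite (le_trans (ler_norm_sum _ _ _)) //.
    apply: (@le_trans _ _ (\sum_j `|psi j y|)).
      apply: ler_sum => j _; rewrite normrM ler_piMr //.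
      exact: (norm_quotient_le1 (fun k => f k y)).
    by move: h; rewrite ltr_norml => /andP [_ /ltW]; rewrite lerBlDl.
have /choice [S1 S1P] := limphi.
have /choice [S2 S2P] : forall j, exists S : 'I_r -> seq 'rV[R]_n, forall i x,
    X x -> x \notin S i -> exists l, has_limit U (Q j i) x l.
  by move=> j; have /choice [S SP] := limQ j; exists S.
pose S := flatten [seq S1 i | i <- enum 'I_r] ++
  flatten [seq flatten [seq S2 j i | i <- enum 'I_r] | j <- enum 'I_r].
have S1S i x : x \notin S -> x \notin S1 i.
  rewrite mem_cat negb_or => /andP [+ _]; apply: contra => xS.
  by apply/flattenP; exists (S1 i) => //; apply: map_f; rewrite mem_enum.
have S2S j i x : x \notin S -> x \notin S2 j i.
  rewrite mem_cat negb_or => /andP [_]; apply: contra => xS.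
  apply/flattenP; exists (flatten [seq S2 j i | i <- enum 'I_r]).
    by apply: map_f; rewrite mem_enum.
  by apply/flattenP; exists (S2 j i) => //; apply: map_f; rewrite mem_enum.
have /choice [T TP] : forall j, exists p : P, forall a, a \in S -> peval p a = psi j a.
  by move=> j; exact: interpolation.
(* This is [(phi - \sum_j T_j f_j) f_i / N + T_i], expanded so that off [S] every summand has a
   limit. *)
pose H i y := phi y * f i y / N y + \sum_j peval (- T j) y * Q j i y + peval (T i) y.
have HE i y : X y -> H i y = \sum_j (psi j y - peval (T j) y) * Q j i y + peval (T i) y.
  move=> Xy; rewrite /H quotE // -big_split; congr (_ + _); apply: eq_bigr => j _ /=.
  by rewrite -!evalatE rmorphN mulrBl mulNr.
have limH i x : X x -> exists l, has_limit U (H i) x l.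
  (* On [S] the form in [HE] is used: the differences [psi_j - T_j] tend to 0 and [|Q j i| <= 1]. *)
  move=> Xx; have [xS|xS] := boolP (x \in S).
    exists (0 + peval (T i) x).
    apply: (@has_limit_ext _ _ U (fun y => \sum_j (psi j y - peval (T j) y) * Q j i y +
      peval (T i) y)).
      by move=> y; rewrite inE => /UX /HE.
    apply: has_limitD; last exact: has_limit_peval.
    apply: (@has_limit_squeeze _ _ (fun y => \sum_j `|psi j y - peval (T j) y|)) => [y Uy|].
      rewrite (le_trans (ler_norm_sum _ _ _)) //; apply: ler_sum => j _.
      rewrite normrM ler_piMr //; exact: (norm_quotient_le1 (fun k => f k y)).
    have E0 : \sum_(j < r) `|psi j x - peval (T j) x| = 0.
      by rewrite big1 // => j _; rewrite TP // subrr normr0.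
    rewrite -[X in has_limit _ _ _ X]E0; apply: has_limit_sum => j.
    apply: has_limit_norm; apply: has_limitD.
      exact: psilim.
    by apply: has_limitN; exact: has_limit_peval.
  have [l0 l0P] := S1P i x Xx (S1S i x xS).
  have /choice [l lP] : forall j, exists l, has_limit U (Q j i) x l.
    by move=> j; apply: (S2P j i x Xx); exact: S2S.
  eexists; apply: has_limitD; last exact: has_limit_peval.
  apply: has_limitD; first exact: l0P.
  by apply: has_limit_sum => j; apply: has_limitM; [exact: has_limit_peval|exact: lP].
have /choice [g gP] : forall i, exists g : 'rV[R]_n -> R, forall x, X x ->
    has_limit U (H i) x (g x).
  move=> i; have /choice [g gP] : forall x, exists l, X x -> has_limit U (H i) x l.
    move=> x; have [Xx|nXx] := pselect (X x); last by exists 0.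
    by have [l lP] := limH i x Xx; exists l.
  by exists g.
exists g => [i|x Xx].
  split; first exact: (has_limit_extension nearU (gP i)).
  (* On [U] the function [H i] is regular, hence continuous, so its extension [g i] agrees with it
     there. *)
  exists U; split=> // x Ux.
  have regH : regular_on U (H i) := regphi i T (T i).
  have [V [p [q [oV Vx pq]]]] := regH x Ux.
  exists V, p, q; split=> // y Vy; have [q0 HEy] := pq y Vy; split=> //.
  rewrite -HEy; have [V' _ VE] := oV.
  have Uy : U y by move: Vy; rewrite VE => -[].
  have [A' [B' AB']] := regular_quotient regH.
  apply: (has_limit_unique (nearU y (UX _ Uy)) (gP i y (UX _ Uy))).
  have [B'0 ->] := AB' y Uy; apply: quotient_limit => //.
  by exists 1 => // z Uz _; have [] := AB' z Uz.
have limf (h : 'rV[R]_n -> R) : {within X, continuous h} -> has_limit U h x (h x).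
  by move=> /within_continuousP h'; apply: (has_limit_sub UX); exact: h'.
apply: (has_limit_unique (nearU x Xx) (limf phi cphi)).
apply: (@has_limit_ext _ _ U (fun y => \sum_i H i y * f i y)); last first.
  apply: has_limit_sum => i; apply: has_limitM; first exact: gP.
  by apply: limf; have [] := hf i.
(* As [\sum_i Q j i f_i = f_j], the sum becomes [\sum_j (psi_j - T_j) f_j + \sum_j T_j f_j]. *)
move=> y; rewrite inE => /UX Xy; rewrite phiE //.
transitivity (\sum_i (\sum_j (psi j y - peval (T j) y) * Q j i y * f i y +
    peval (T i) y * f i y)).
  by apply: eq_bigr => i _; rewrite HE // mulrDl mulr_suml.
rewrite big_split exchange_big -big_split /=; apply: eq_bigr => j _.
under eq_bigr do rewrite -mulrA.
rewrite -mulr_sumr (sum_quotient (fun k => f k y)); ring.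
Qed.

End Main.

Theorem corollary1p7 (R : realType) (n : nat) (X : set 'rV[R]_n)
    (hX : algebraic_surface X) (hns : nonsingular X)
    (r : nat) (f : 'I_r -> 'rV[R]_n -> R)
    (hf : forall i, continuous_rational X (f i))
    (phi : 'rV[R]_n -> R) (hphi : continuous_rational X phi) :
  (exists2 g : 'I_r -> 'rV[R]_n -> R,
     (forall i, continuous_rational X (g i)) &
     (forall x, X x -> phi x = \sum_(i < r) g i x * f i x))
  <->
  (exists2 g : 'I_r -> 'rV[R]_n -> R,
     (forall i, {within X, continuous (g i)}) &
     (forall x, X x -> phi x = \sum_(i < r) g i x * f i x)).
Proof.
split=> -[g hg phiE]; first by exists g => // i; have [] := hg i.
exact: continuous_rational_solution phiE.
Qed.
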